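(* Let $\mu\in\mathbb{R}$, $\sigma>0$, $S_0>0$ be constants, let $\tilde\mu=\mu-\sigma^2/2$, and let $S_t=S_0\exp(\tilde\mu t+\sigma B_t)$ for $t\ge0$. Let $\tau>0$, $\omega>0$, and let $T$ be a random variable independent of $(B_t)_{t\ge0}$ with the inverse Gaussian distribution $\mathrm{IG}(\tau,\omega)$ with mean $\tau$ and shape parameter $\omega$. Then the probability density function of $S_T$ is, for $x>0$, $$f_{\mathrm{IG}}(x)=\frac{\sqrt{\omega}\,e^{\omega/\tau}}{\pi\sigma S_0}\left(\frac{x}{S_0}\right)^{\tilde\mu/\sigma^2-1}\left(\frac{(\ln(x/S_0))^2}{\sigma^2}+\omega\right)^{-1/2}\left(\frac{\tilde\mu^2}{\sigma^2}+\frac{\omega}{\tau^2}\right)^{1/2}K_{1}\!\left(\sqrt{\left(\frac{(\ln(x/S_0))^2}{\sigma^2}+\omega\right)\left(\frac{\tilde\mu^2}{\sigma^2}+\frac{\omega}{\tau^2}\right)}\right).$$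
   Context: $(B_t)_{t\ge0}$ is a standard one-dimensional Brownian motion with $B_0=0$; $S_t$ is geometric Brownian motion, the It\^o solution of $dS_t=\mu S_t\,dt+\sigma S_t\,dB_t$ started at $S_0$, and $S_T$ is its value at the random time $T$. $K_\nu$ is the modified Bessel function of the second kind. $\mathrm{IG}(\tau,\omega)$ is the distribution on $(0,\infty)$ with density $\sqrt{\frac{\omega}{2\pi t^3}}\exp\left(-\frac{\omega(t-\tau)^2}{2\tau^2 t}\right)$. *)

(* Defs.v *)
From HB Require Import structures.
From mathcomp Require Import all_boot all_order all_algebra.
From mathcomp Require Import all_classical all_reals all_analysis.
Set Implicit Arguments.
Unset Strict Implicit.
Unset Printing Implicit Defensive.
Import Order.TTheory GRing.Theory Num.Theory.
Import numFieldTopology.Exports numFieldNormedType.Exports.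
Local Open Scope classical_set_scope.
Local Open Scope ring_scope.

(* DLMF 10.25.1-10.25.3, on the positive half-line: K_nu is the solution of
   x^2 w'' + x w' - (x^2 + nu^2) w = 0 with
   w(x) ~ sqrt(pi / (2x)) exp(-x) as x -> +oo.
   Values at x <= 0 are unconstrained and must not be relied upon. *)
Definition is_besselK {R : realType} (nu : R) (K : R -> R) : Prop :=
  (forall x : R, 0 < x ->
    [/\ derivable K x 1, derivable (derive1 K) x 1 &
        x ^+ 2 * derive1 (derive1 K) x + x * derive1 K x
          - (x ^+ 2 + nu ^+ 2) * K x = 0])
  /\ (K x / (Num.sqrt (pi / (2 * x)) * expR (- x)) @[x --> +oo] --> (1 : R)).

(* The two conditions determine K_nu uniquely on x > 0. *)
Definition besselK {R : realType} (nu : R) : R -> R :=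
  xget (fun=> 0) [set K : R -> R | is_besselK nu K].

Definition has_pdf {R : realType} {d : measure_display}
    {Omega : measurableType d} (P : probability Omega R)
    (X : Omega -> R) (f : R -> R) : Prop :=
  [/\ measurable_fun [set: Omega] X,
      measurable_fun [set: R] f,
      forall x : R, 0 <= f x &
      forall A : set R, measurable A ->
        P (X @^-1` A) = (\int[lebesgue_measure]_(x in A) (f x)%:E)%E].

Definition increment {R : realType} {Omega : Type} (B : R -> Omega -> R)
    (s t : R) (w : Omega) : R := B t w - B s w.

(* Only the times t >= 0 of a process B : R -> Omega -> R are meaningful. *)
Definition standard_brownian_motion {R : realType} {d : measure_display}
    {Omega : measurableType d} (P : probability Omega R)
    (B : R -> Omega -> R) : Prop :=
  [/\ forall t : R, 0 <= t -> measurable_fun [set: Omega] (B t),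
      {ae P, forall w, B 0 w = 0},
      forall w, {within `[0, +oo[, continuous (fun t : R => B t w)},
      forall s t : R, 0 <= s -> s < t -> forall A : set R, measurable A ->
        P (increment B s t @^-1` A) = normal_prob 0 (Num.sqrt (t - s)) A &
      (* Taking some A i := setT gives the product rule for subfamilies. *)
      forall (n : nat) (t : nat -> R) (A : nat -> set R),
        0 <= t 0%N -> (forall i, (i < n)%N -> t i <= t i.+1) ->
        (forall i, measurable (A i)) ->
        P (\bigcap_(i in `I_n) (increment B (t i) (t i.+1) @^-1` A i))
        = (\prod_(i < n) P (increment B (t i) (t i.+1) @^-1` A i))%E].

Definition sigma_process {R : realType} {Omega : Type}
    (B : R -> Omega -> R) : set (set Omega) :=
  <<s [set E | exists (t : R) (A : set R),
         [/\ 0 <= t, measurable A & E = B t @^-1` A] ] >>.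

Definition independent_of_process {R : realType} {d : measure_display}
    {Omega : measurableType d} (P : probability Omega R)
    (T : Omega -> R) (B : R -> Omega -> R) : Prop :=
  forall (A : set R) (E : set Omega),
    measurable A -> sigma_process B E ->
    P (T @^-1` A `&` E) = (P (T @^-1` A) * P E)%E.

Definition inverse_gaussian_pdf {R : realType} (tau omega t : R) : R :=
  if 0 < t then
    Num.sqrt (omega / (2 * pi * t ^+ 3))
    * expR (- (omega * (t - tau) ^+ 2 / (2 * tau ^+ 2 * t)))
  else 0.

Definition log_drift {R : realType} (mu sigma : R) : R := mu - sigma ^+ 2 / 2.

Definition gbm {R : realType} {Omega : Type} (mu sigma S0 : R)
    (B : R -> Omega -> R) (t : R) (w : Omega) : R :=
  S0 * expR (log_drift mu sigma * t + sigma * B t w).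

Definition gbm_ig_pdf {R : realType} (mu sigma S0 tau omega x : R) : R :=
  if 0 < x then
    let m := log_drift mu sigma in
    let a := ln (x / S0) ^+ 2 / sigma ^+ 2 + omega in
    let b := m ^+ 2 / sigma ^+ 2 + omega / tau ^+ 2 in
    Num.sqrt omega * expR (omega / tau) / (pi * sigma * S0)
    * (x / S0) `^ (m / sigma ^+ 2 - 1)
    * a `^ (- (1 / 2)) * b `^ (1 / 2)
    * besselK 1 (Num.sqrt (a * b))
  else 0.

(* Main.v *)
Require Import Defs.
From HB Require Import structures.
From mathcomp Require Import all_boot all_order all_algebra.
From mathcomp Require Import ring lra.
From mathcomp Require Import all_classical all_reals all_analysis.
From mathcomp Require Import measurable_realfun.
Set Implicit Arguments.
Unset Strict Implicit.
Unset Printing Implicit Defensive.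
Import Order.TTheory GRing.Theory Num.Theory.
Import numFieldTopology.Exports numFieldNormedType.Exports.
Local Open Scope classical_set_scope.
Local Open Scope ring_scope.

(** Conditionally on [T = t] the variable [S_T] is lognormal, because [T] is
    independent of the whole path. Hence the law of [S_T] is the mixture, over
    the inverse Gaussian density in [t], of the lognormal laws of [S_t]
    ([probability_at_random_time], [gbm_marginal]), and Tonelli's theorem turns
    the mixture into a density: at [x] it is the integral over [t > 0] of a joint
    kernel. Expanding the squares in the two exponents ([mixture_kernelE]) shows
    that this kernel is a function of [x] times t^-2 exp (- (a / t + b t) / 2),
    with a = (ln (x / S0))^2 / sigma^2 + omega and
    b = m^2 / sigma^2 + omega / tau^2, where m = mu - sigma^2 / 2 is the log
    drift. The integral over [t] is 2 sqrt (b / a) K_1 (sqrt (a b))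
    ([integral_inv_sqr_expR]), which is the asserted formula.

    Since K_1 is given only by its differential equation and its behaviour at
    infinity, it has to be identified with the integral that actually occurs,
    K_1 (x) = 1/2 int_R cosh s exp (- x cosh s) ds. Everything is written in the
    variable v = 2 sinh (s / 2), in which cosh s = 1 + v^2 / 2: the exponential
    becomes Gaussian, so integrability and the asymptotics at infinity come from
    the normal density ([bessel_ratio_le]). The equation follows by
    differentiating under the integral sign, as the resulting integrand is a
    total derivative ([bessel_moment_ode]). Finally, two functions with the
    defining properties of K_1 agree on the positive half-line by a Wronskian
    argument ([is_besselK_unique]).

    On the probabilistic side, independence says that the pair formed by [T] and
    the path has a product law, so the probability of an event on [S_T] is an
    integral of probabilities at fixed times; the map (t, path) |-> B_t is
    jointly measurable because paths are continuous
    ([measurable_continuous_process]). *)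

(** * Densities and substitution *)

(** The proofs [mw] and [w0] are arguments so that the measure structure
    declared below can be inferred from the term. *)
Definition density_measure {d : measure_display} {T : measurableType d}
    {R : realType} (mu : {measure set T -> \bar R}) (w : T -> R)
    (mw : measurable_fun setT w) (w0 : forall x, 0 <= w x) (A : set T) :=
  (\int[mu]_(x in A) (w x)%:E)%E.

Section density_measure.
Context {d : measure_display} {T : measurableType d} {R : realType}.
Variables (mu : {measure set T -> \bar R}) (w : T -> R).
Hypotheses (mw : measurable_fun setT w) (w0 : forall x, 0 <= w x).
Local Notation nu := (density_measure mu mw w0).

Let nu0 : nu set0 = 0%E. Proof. exact: integral_set0. Qed.

Let nu_ge0 A : (0 <= nu A)%E.
Proof. by apply: integral_ge0 => x _; rewrite lee_fin. Qed.

Let nu_sigma_additive : semi_sigma_additive nu.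
Proof.
move=> F mF tF mUF; rewrite /density_measure ge0_integral_bigcup//; last 2 first.
- exact/measurable_EFinP/measurable_funTS.
- by move=> x _; rewrite lee_fin.
by apply: is_cvg_ereal_nneg_natsum_cond => n _ _; exact: nu_ge0.
Qed.

HB.instance Definition _ := isMeasure.Build _ _ _ nu nu0 nu_ge0 nu_sigma_additive.

Import HBNNSimple.

(** By monotone convergence it suffices to treat indicators, for which this is
    the definition of the measure. *)
Lemma integral_density_measure (f : T -> \bar R) : measurable_fun setT f ->
  (forall x, 0 <= f x)%E ->
  (\int[nu]_x f x = \int[mu]_x (f x * (w x)%:E))%E.
Proof.
move=> mf f0; pose h := nnsfun_approx measurableT mf.
have cvgh x : (EFin \o h n) x @[n --> \oo] --> f x.
  by apply: cvg_nnsfun_approx => // y _; exact: f0.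
have ndh x m n : (m <= n)%N -> (h m x <= h n x).
  by move=> mn; exact/lefP/nd_nnsfun_approx.
have mh n : measurable_fun setT (EFin \o h n).
  by apply/measurable_EFinP; exact/measurable_funP.
have mEw : measurable_fun setT (EFin \o w) by exact/measurable_EFinP.
have E1 : (\int[nu]_x f x = limn (fun n => \int[nu]_x (EFin \o h n) x))%E.
  rewrite -monotone_convergence//.
  - by apply: eq_integral => x _; apply/esym/cvg_lim => //.
  - by move=> n x _; rewrite lee_fin.
  - by move=> x _ m n mn; rewrite lee_fin ndh.
have E2 : (\int[mu]_x (f x * (w x)%:E) =
    limn (fun n => \int[mu]_x ((EFin \o h n) x * (w x)%:E)))%E.
  rewrite -monotone_convergence//.
  - apply: eq_integral => x _; apply/esym/cvg_lim => //.
    by apply: cvgeZr => //; exact: cvgh.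
  - by move=> n; exact: emeasurable_funM.
  - by move=> n x _; rewrite mule_ge0// lee_fin.
  - by move=> x _ m n mn; rewrite lee_wpmul2r ?lee_fin// ndh.
rewrite E1 E2; congr (limn _); apply/funext => n.
have indich r : measurable_fun setT (fun x => (r * \1_(h n @^-1` [set r]) x)%:E).
  by apply/measurable_EFinP; exact: measurable_funM.
transitivity (\int[nu]_x
   (\sum_(y \in range (h n)) (y * \1_(h n @^-1` [set y]) x)%:E))%E.
  by apply: eq_integral => t tE; rewrite /= fimfunE -fsumEFin.
rewrite ge0_integral_fsum//; last by move=> m y Ey; exact: nnfun_muleindic_ge0.
transitivity (\int[mu]_x (\sum_(y \in range (h n))
    (y * \1_(h n @^-1` [set y]) x)%:E * (w x)%:E))%E; last first.
  under eq_integral => x xE.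
    rewrite -ge0_mule_fsuml => [|y]; last exact: nnfun_muleindic_ge0.
    rewrite fsumEFin // -(fimfunE _ x); over.
  by [].
rewrite ge0_integral_fsum//; last 2 first.
- by move=> y; apply: emeasurable_funM.
- move=> m y Ey; apply: mule_ge0; last by rewrite lee_fin.
  exact: (nnfun_muleindic_ge0 (h n) m y).
apply: eq_fsbigr => r rhn.
under eq_integral do rewrite EFinM.
rewrite integralZl_indic_nnsfun => //.
under [RHS]eq_integral do rewrite EFinM -muleA.
rewrite ge0_integralZl//; last 3 first.
- by apply: emeasurable_funM => //; exact/measurable_EFinP.
- by move=> t Et; rewrite mule_ge0 ?lee_fin.
- by move: rhn; rewrite inE => -[t _ <-]; rewrite lee_fin.
congr (_ * _)%E.
rewrite integral_indic//= setIT /density_measure integral_mkcond.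
by apply: eq_integral => x _; rewrite epatch_indic/= muleC.
Qed.

End density_measure.

(** The measure of density [w] on [D], pushed forward by [psi], agrees with
    Lebesgue measure on half-open intervals, hence on all Borel sets. The
    integrand [g] may thus be discontinuous, such as the indicator of a Borel
    set. *)
Lemma ge0_integral_substitution {R : realType} (D : set R) (psi w : R -> R)
    (g : R -> \bar R) :
  measurable D -> measurable_fun D psi -> measurable_fun D w ->
  (forall x, D x -> 0 <= w x) ->
  (forall a b : R, (a < b)%R ->
    \int[lebesgue_measure]_(x in D `&` psi @^-1` [set y | (a < y <= b)%R]) (w x)%:E
    = (b - a)%:E)%E ->
  measurable_fun setT g -> (forall x, 0 <= g x)%E ->
  (\int[lebesgue_measure]_x g x =
   \int[lebesgue_measure]_(x in D) (g (psi x) * (w x)%:E))%E.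
Proof.
move=> mD mpsi mw w0 H mg g0.
pose wD := w \_ D; pose pD := psi \_ D.
have mwD : measurable_fun setT wD by exact/(measurable_restrictT _ mD).
have mpD : measurable_fun setT pD by exact/(measurable_restrictT _ mD).
have wD0 x : 0 <= wD x.
  by rewrite /wD patchE; case: ifPn => // /set_mem/w0.
pose nu := pushforward (density_measure lebesgue_measure mwD wD0)
  (pD : _ -> measurableTypeR R).
have nuE A : measurable A -> nu A =
    (\int[lebesgue_measure]_(x in D `&` psi @^-1` A) (w x)%:E)%E.
  move=> mA; rewrite /nu /pushforward /density_measure.
  rewrite integral_mkcond [RHS]integral_mkcond; apply: eq_integral => x _.
  rewrite !patchE /pD /wD !patchE in_setI.
  have [xD|xD] := boolP (x \in D); last by case: ifP.
  rewrite /=; congr (if _ then _ else _).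
  by apply/idP/idP => /set_mem/= h; apply/mem_set => /=; move: h; rewrite patchE xD.
have munu A : measurable A -> lebesgue_measure A = nu A.
  rewrite /nu; move: A; apply/lebesgue_measure_unique => //= _ [[a b]] _ <-/=.
  have [ab|ba] := ltP a b.
    rewrite -/nu nuE// lebesgue_measure_itv/= lte_fin ab -EFinD -H//.
  by rewrite set_itv_ge ?bnd_simp -?leNgt// /pushforward preimage_set0 !measure0.
transitivity (\int[nu]_x g x)%E.
  by apply: eq_measure_integral => A mA _; exact: munu.
rewrite ge0_integral_pushforward// preimage_setT integral_density_measure//;
  last 2 first.
- by apply: measurableT_comp.
- by move=> x /=.
rewrite [RHS]integral_mkcond; apply: eq_integral => x _ /=.
by rewrite /pD /wD !patchE; case: ifP => // _; rewrite mule0.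
Qed.

(** An increasing bijection [psi] from the positive half-line onto the line pulls
    ]a, b] back to ]phi a, phi b], over which its derivative [w] integrates to
    b - a by the fundamental theorem of calculus. *)
Lemma ge0_integral_substitution_pos {R : realType} (psi phi w : R -> R)
    (g : R -> \bar R) :
  (forall v : R, 0 < phi v) -> cancel phi psi ->
  (forall x y : R, 0 < x -> x < y -> psi x < psi y) ->
  (forall x : R, 0 < x -> is_derive x 1 psi (w x)) ->
  (forall x : R, 0 < x -> {for x, continuous w}) ->
  (forall x : R, 0 < x -> 0 <= w x) ->
  measurable_fun setT g -> (forall x, 0 <= g x)%E ->
  (\int[lebesgue_measure]_x g x =
   \int[lebesgue_measure]_(x in `]0%R, +oo[) (g (psi x) * (w x)%:E))%E.
Proof.
move=> phi0 phiK ipsi dpsi cw w0 mg g0.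
have cpsi x : 0 < x -> {for x, continuous psi}.
  move=> x0; apply/differentiable_continuous/derivable1_diffP.
  by have [] := dpsi _ x0.
have Dlt x y : 0 < x -> 0 < y -> (psi x < psi y) = (x < y).
  move=> x0 y0; have [xy|yx|->] := ltgtP x y; last by rewrite ltxx.
    exact: ipsi.
  by apply/negbTE; rewrite -leNgt ltW// ipsi.
have mw : measurable_fun (`]0, +oo[%classic : set R) w.
  apply: open_continuous_measurable_fun => // x; rewrite inE/= in_itv/= andbT.
  exact: cw.
apply: ge0_integral_substitution => //.
- apply: open_continuous_measurable_fun => // x; rewrite inE/= in_itv/= andbT.
  exact: cpsi.
- by move=> x; rewrite /= in_itv/= andbT; exact: w0.
move=> a b ab.
have phiab : phi a < phi b by rewrite -Dlt// !phiK.
have -> : `]0, +oo[%classic `&` psi @^-1` [set y | a < y <= b] =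
    `]phi a, phi b]%classic.
  apply/seteqP; split => x /=; rewrite !in_itv/= ?andbT.
    case=> x0 /andP[ax xb].
    by rewrite -Dlt// phiK ax/= leNgt -Dlt// phiK -leNgt.
  move=> /andP[ax xb]; have x0 : 0 < x := lt_trans (phi0 a) ax.
  by split=> //; rewrite -{1}(phiK a) -(phiK b) Dlt// ax/= leNgt Dlt// -leNgt.
have pos x : phi a <= x -> 0 < x by exact: lt_le_trans (phi0 a).
rewrite integral_itv_obnd_cbnd; last first.
  apply/measurable_EFinP; apply: measurable_funS mw => // x.
  by rewrite /= !in_itv/= andbT => /andP[/ltW/pos].
rewrite (@continuous_FTC2 _ _ psi)//.
- by rewrite !phiK EFinB.
- apply: continuous_in_subspaceT => x; rewrite inE/= in_itv/= => /andP[/pos x0 _].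
  exact: cw.
- split.
  + by move=> x; rewrite in_itv/= => /andP[/ltW/pos/dpsi[]].
  + by apply: cvg_at_right_filter; exact: cpsi.
  + by apply: cvg_at_left_filter; exact: cpsi.
- move=> x; rewrite in_itv/= => /andP[/ltW/pos/dpsi d _].
  by rewrite derive1E derive_val.
Qed.

(** * Moments of the Bessel integrand *)

Section bessel_moments.
Context {R : realType}.
Implicit Types (x y v t s : R) (n : nat).
Local Notation mu := (@lebesgue_measure R).

(** With v = 2 sinh (s / 2), [bcosh v] is cosh s and [bhcosh v] is
    cosh (s / 2). Since dv = cosh (s / 2) ds, [bessel_moment n x] is one half of
    the integral over the line of (cosh s)^n exp (- x cosh s) ds; for n = 1 this
    is K_1 (x). *)
Definition bcosh v : R := 1 + v ^+ 2 / 2.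
Definition bhcosh v : R := Num.sqrt (1 + v ^+ 2 / 4).
Definition bessel_integrand n x v : R :=
  bcosh v ^+ n / bhcosh v * expR (- (x * bcosh v)).
Definition bessel_moment n x : R := 2^-1 * \int[mu]_v bessel_integrand n x v.

Lemma bcosh_ge1 v : 1 <= bcosh v.
Proof. by rewrite /bcosh lerDl divr_ge0// sqr_ge0. Qed.

Lemma bcosh_gt0 v : 0 < bcosh v. Proof. exact: lt_le_trans (bcosh_ge1 v). Qed.

Lemma bhcosh_sqr v : bhcosh v ^+ 2 = 1 + v ^+ 2 / 4.
Proof. by rewrite sqr_sqrtr// addr_ge0// divr_ge0// sqr_ge0. Qed.

Lemma bhcosh_ge1 v : 1 <= bhcosh v.
Proof.
rewrite -(@sqrtr1 R) ler_sqrt ?lerDl ?divr_ge0 ?sqr_ge0//.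
by rewrite addr_ge0 ?divr_ge0 ?sqr_ge0.
Qed.

Lemma bhcosh_gt0 v : 0 < bhcosh v. Proof. exact: lt_le_trans (bhcosh_ge1 v). Qed.

Lemma bhcosh_le_bcosh v : bhcosh v <= bcosh v.
Proof.
rewrite -(@ler_pXn2r _ 2)// ?nnegrE ?(ltW (bhcosh_gt0 v)) ?(ltW (bcosh_gt0 v))//.
rewrite bhcosh_sqr /bcosh; have := sqr_ge0 v; nra.
Qed.

(** In terms of s this is |2 sinh (s / 2) cosh (s / 2)| = |sinh s| <= cosh s. *)
Lemma normM_bhcosh_le_bcosh v : `|v| * bhcosh v <= bcosh v.
Proof.
rewrite -(@ler_pXn2r _ 2)// ?nnegrE ?(ltW (bcosh_gt0 v))//; last first.
  by rewrite mulr_ge0// ltW// bhcosh_gt0.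
rewrite exprMn bhcosh_sqr /bcosh real_normK ?num_real//; have := sqr_ge0 v; nra.
Qed.

Lemma continuous_bcosh : continuous bcosh.
Proof.
move=> v; apply: cvgD; first exact: cvg_cst.
by apply: cvgMr_tmp; apply: exprn_continuous.
Qed.

Lemma continuous_bhcosh : continuous bhcosh.
Proof.
move=> v; apply: continuous_comp; last exact: sqrt_continuous.
apply: cvgD; first exact: cvg_cst.
by apply: cvgMr_tmp; apply: exprn_continuous.
Qed.

Lemma continuous_bessel_integrand n x : continuous (bessel_integrand n x).
Proof.
move=> v; apply: cvgM.
  apply: cvgM; last first.
    by apply: cvgV; [rewrite gt_eqF ?bhcosh_gt0|exact: continuous_bhcosh].
  apply: (@continuous_comp _ _ _ bcosh (fun y => y ^+ n)).
    exact: continuous_bcosh.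
  exact: exprn_continuous.
apply: (@continuous_comp _ _ _ (fun v => - (x * bcosh v))); last exact: continuous_expR.
by apply: cvgN; apply: cvgMl_tmp; exact: continuous_bcosh.
Qed.

Lemma measurable_bessel_integrand n x : measurable_fun setT (bessel_integrand n x).
Proof. apply: continuous_measurable_fun; exact: continuous_bessel_integrand. Qed.

Lemma bessel_integrand_ge0 n x v : 0 <= bessel_integrand n x v.
Proof.
have c0 := ltW (bcosh_gt0 v); have q0 := ltW (bhcosh_gt0 v).
by rewrite /bessel_integrand mulr_ge0 ?expR_ge0// divr_ge0 ?exprn_ge0.
Qed.

Lemma integrable_gauss (y : R) : 0 < y ->
  mu.-integrable setT (EFin \o (fun v => expR (- (y * v ^+ 2)))).
Proof.
move=> y0; pose s := Num.sqrt ((2 * y)^-1).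
have s0 : s != 0 by rewrite gt_eqF// sqrtr_gt0 invr_gt0 mulr_gt0.
have := @integrable_normal_pdf R 0 s.
move=> /(@integrableZl _ _ _ mu setT measurableT (normal_peak s)^-1).
apply: eq_integrable => // v _ /=; rewrite -EFinM normal_pdfE//.
rewrite mulKf ?gt_eqF ?normal_peak_gt0// /normal_fun subr0.
rewrite /s sqr_sqrtr ?invr_ge0 ?mulr_ge0 ?(ltW y0)//; congr (expR _)%:E.
by rewrite -mulr_natr; field; rewrite gt_eqF.
Qed.

(** A single term of the exponential series is below its sum. *)
Lemma powXexpR_le n (y : R) : 0 <= y -> y ^+ n * expR (- y) <= n`!%:R.
Proof.
move=> y0; rewrite expRN ler_pdivrMr ?expR_gt0//.
case: n => [|n]; first by rewrite expr0 mul1r -expR0 ler_expR.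
have f0 : 0 < (n.+1)`!%:R :> R by rewrite ltr0n fact_gt0.
have h := expR_ge1Dxn n y0.
by rewrite mulrC -ler_pdivrMr//; lra.
Qed.

Lemma bcoshX_expR_le n x v : 0 < x ->
  bcosh v ^+ n * expR (- (x * bcosh v)) <= n`!%:R / x ^+ n.
Proof.
move=> x0; rewrite ler_pdivlMr ?exprn_gt0//.
rewrite mulrAC -exprMn (mulrC (bcosh v)); apply: powXexpR_le.
by rewrite mulr_ge0 ?ltW// bcosh_gt0.
Qed.

(** One half of the exponent absorbs the polynomial factor; the other half is a
    Gaussian in [v]. *)
Lemma bessel_integrand_le_gauss n x v : 0 < x ->
  bessel_integrand n x v <= n`!%:R / (x / 2) ^+ n * expR (- (x / 4 * v ^+ 2)).
Proof.
move=> x0; have x20 : 0 < x / 2 by rewrite divr_gt0.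
apply: (@le_trans _ _ (bcosh v ^+ n * expR (- (x * bcosh v)))).
  rewrite /bessel_integrand ler_pM2r ?expR_gt0// ler_pdivrMr ?bhcosh_gt0//.
  by rewrite ler_peMr ?bhcosh_ge1// exprn_ge0// ltW// bcosh_gt0.
have -> : - (x * bcosh v) = - (x / 2 * bcosh v) + - (x / 2 * bcosh v) by field.
have c0 := ltW (bcosh_gt0 v); rewrite expRD mulrA.
apply: ler_pM; rewrite ?mulr_ge0 ?expR_ge0 ?exprn_ge0//.
  exact: bcoshX_expR_le.
by rewrite ler_expR lerN2 /bcosh; have := sqr_ge0 v; nra.
Qed.

Lemma integrable_bessel_integrand n x : 0 < x ->
  mu.-integrable setT (EFin \o bessel_integrand n x).
Proof.
move=> x0; have x4 : 0 < x / 4 by rewrite divr_gt0.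
have := integrable_gauss x4.
move=> /(@integrableZl _ _ _ mu setT measurableT (n`!%:R / (x / 2) ^+ n)).
apply: le_integrable => //.
  by apply/measurable_EFinP; exact: measurable_bessel_integrand.
move=> v _ /=; rewrite lee_fin ger0_norm ?bessel_integrand_ge0//.
by apply: le_trans (ler_norm _); exact: bessel_integrand_le_gauss.
Qed.

Lemma is_derive_bessel_integrand n x v :
  is_derive x 1 (fun y => bessel_integrand n y v) (- bessel_integrand n.+1 x v).
Proof.
rewrite /bessel_integrand; apply: is_derive_eq.
by rewrite ?scaler0 ?addr0 ?add0r /GRing.scale/= exprS; ring.
Qed.

Lemma ler_bessel_integrand n x y v : x <= y ->
  bessel_integrand n y v <= bessel_integrand n x v.
Proof.
move=> xy; rewrite /bessel_integrand ler_wpM2l//.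
  by rewrite divr_ge0 ?exprn_ge0 ?ltW ?bcosh_gt0 ?bhcosh_gt0.
by rewrite ler_expR lerN2 ler_pM2r ?bcosh_gt0.
Qed.

(** Differentiation under the integral sign: near [x] the derivative of the
    integrand is dominated by its value at [x / 2], because the integrand
    decreases in its parameter. *)
Lemma is_derive_bessel_moment n x : 0 < x ->
  is_derive x 1 (bessel_moment n) (- bessel_moment n.+1 x).
Proof.
move=> x0.
have Ix : `]x / 2, x + 1[%classic x by rewrite /= in_itv/=; apply/andP; split; lra.
have x20 : 0 < x / 2 by rewrite divr_gt0.
have pos y : `]x / 2, x + 1[%classic y -> 0 < y.
  by rewrite /= in_itv/= => /andP[? _]; lra.
have intf y : `]x / 2, x + 1[%classic y ->
    mu.-integrable setT (EFin \o bessel_integrand n y).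
  by move/pos/integrable_bessel_integrand.
have derf y v : `]x / 2, x + 1[%classic y -> setT v ->
    derivable (bessel_integrand n ^~ v) y 1.
  by move=> _ _; have [] := is_derive_bessel_integrand n y v.
have pE y v : partial1of2 (bessel_integrand n) y v = - bessel_integrand n.+1 y v.
  rewrite partial1of2E.
  by rewrite (@derive_val _ _ _ _ _ _ _ (is_derive_bessel_integrand n y v)).
have Gub y v : `]x / 2, x + 1[%classic y -> setT v ->
    `|partial1of2 (bessel_integrand n) y v| <= bessel_integrand n.+1 (x / 2) v.
  move=> + _; rewrite /= in_itv/= => /andP[/ltW xy _].
  by rewrite pE normrN ger0_norm ?bessel_integrand_ge0// ler_bessel_integrand.
have iG := integrable_bessel_integrand n.+1 x20.
have G0 v := bessel_integrand_ge0 n.+1 (x / 2) v.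
have d := derivable_under_integral measurableT Ix intf derf G0 iG Gub.
have dE := differentiation_under_integral measurableT Ix intf derf G0 iG Gub.
have D : is_derive x 1 (fun y => \int[mu]_v bessel_integrand n y v)
    (- \int[mu]_v bessel_integrand n.+1 x v).
  apply: DeriveDef => //; rewrite -derive1E dE.
  rewrite -mulN1r -RintegralZl//; last exact: integrable_bessel_integrand.
  by apply: eq_Rintegral => v _; rewrite pE mulN1r.
rewrite /bessel_moment; apply: is_derive_eq.
by rewrite /GRing.scale/= mulrN.
Qed.

End bessel_moments.

(** * The Bessel equation *)

Section bessel_equation.
Context {R : realType}.
Implicit Types (x y v t s : R) (n : nat).
Local Notation mu := (@lebesgue_measure R).

(** The integral over [-n, n] is [F n - F (- n)] by the fundamental theorem of
    calculus; dominated convergence lets n tend to infinity. *)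
Lemma Rintegral_derivative_eq0 (F f : R -> R) :
  (forall v : R, is_derive v 1 F (f v)) -> continuous f ->
  mu.-integrable setT (EFin \o f) ->
  F n%:R - F (- n%:R) @[n --> \oo] --> (0 : R) ->
  \int[mu]_v f v = 0.
Proof.
move=> dF cf intf Flim.
have mf : measurable_fun setT f by exact: continuous_measurable_fun.
pose D n : set R := `[- n%:R, n%:R]%classic.
have mD n : measurable (D n) by exact: measurable_itv.
pose f_ n := (EFin \o f) \_ (D n).
have cF : continuous F.
  by move=> v; apply/differentiable_continuous/derivable1_diffP; have [] := dF v.
have fE n : (\int[mu]_v f_ n.+1 v = (F n.+1%:R - F (- n.+1%:R))%:E)%E.
  rewrite /f_ -integral_mkcond (@continuous_FTC2 _ _ F)//.
  - by apply: (@lt_trans _ _ 0); rewrite ?oppr_lt0 ltr0n.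
  - by apply: continuous_in_subspaceT => v _; exact: cf.
  - split.
    + by move=> v _; have [] := dF v.
    + by apply: cvg_at_right_filter; exact: cF.
    + by apply: cvg_at_left_filter; exact: cF.
  - by move=> v _; rewrite derive1E derive_val.
have H : (\int[mu]_v f_ n v)%E @[n --> \oo] --> (\int[mu]_v (f v)%:E)%E.
  have [] // := @dominated_convergence _ _ _ mu setT measurableT f_ (EFin \o f)
    (abse \o (EFin \o f)).
  - move=> n; apply/(measurable_restrictT _ (mD n)).
    by apply/measurable_EFinP; exact: measurable_funTS.
  - exact/measurable_EFinP.
  - apply: aeW => v _; apply: cvg_near_cst.
    near=> n; rewrite /f_ patchE ifT// inE /D/= in_itv/= -ler_norml.
    near: n; exact: nbhs_infty_ger.
  - exact: integrable_abse.
  - apply: aeW => v n _; rewrite /f_ patchE /=.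
    by case: ifP => //= _; rewrite normr0 lee_fin.
have H2 : (\int[mu]_v f_ n v)%E @[n --> \oo] --> (0 : \bar R)%E.
  rewrite -(cvg_shiftS (fun n => \int[mu]_v f_ n v)%E) /=.
  under eq_fun do rewrite fE.
  apply: cvg_EFin; first exact: nearW.
  move: Flim; rewrite -(cvg_shiftS (fun n => F n%:R - F (- n%:R))); exact.
rewrite /Rintegral -(@cvg_unique _ _ _ _ _ _ H2 H)//.
Unshelve. all: end_near. Qed.

Lemma is_derive_bcosh v : is_derive v 1 (@bcosh R) v.
Proof.
rewrite /bcosh; apply: is_derive_eq.
by rewrite /GRing.scale/=; field.
Qed.

Lemma is_derive_bhcosh v : is_derive v 1 (@bhcosh R) (v / (4 * bhcosh v)).
Proof.
have p : 0 < 1 + v ^+ 2 / 4 by rewrite ltr_wpDr// divr_ge0// sqr_ge0.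
rewrite /bhcosh; have ? := is_derive1_sqrt p.
have -> : (fun w : R => Num.sqrt (1 + w ^+ 2 / 4)) =
  Num.sqrt \o (fun w : R => 1 + w ^+ 2 / 4) by [].
apply: is_derive_eq.
rewrite /GRing.scale/= add0r; field.
by rewrite gt_eqF// sqrtr_gt0.
Qed.

Lemma cvg_bcoshX n x : 0 < x ->
  bcosh m%:R ^+ n * expR (- (x * bcosh m%:R)) @[m --> \oo] --> (0 : R).
Proof.
move=> x0; pose C := n.+1`!%:R / x ^+ n.+1.
apply: (@squeeze_cvgr _ _ _ _ (cst 0) (fun m => 2 * C * harmonic m)).
- apply: nearW => m; rewrite mulr_ge0 ?expR_ge0 ?exprn_ge0 ?(ltW (bcosh_gt0 _))//=.
  have := bcoshX_expR_le n.+1 m%:R x0.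
  rewrite -/C exprS -mulrA mulrC -ler_pdivlMr ?bcosh_gt0//.
  move=> /le_trans; apply.
  have -> : 2 * C * harmonic m = C * (2 * harmonic m) by ring.
  rewrite ler_pM2l; last first.
    by rewrite divr_gt0 ?exprn_gt0// ltr0n fact_gt0.
  rewrite -[leRHS]invrK lef_pV2 ?posrE ?bcosh_gt0 ?invr_gt0 ?mulr_gt0 ?invr_gt0 ?ltr0n//.
  rewrite invfM invrK /bcosh -[m.+1%:R]natr1.
  have := ler0n R m; have := sqr_ge0 (m%:R - 1 : R); rewrite !expr2; lra.
- exact: cvg_cst.
- by rewrite -(mulr0 (2 * C)); apply: cvgMl_tmp; exact: cvg_harmonic.
Qed.

End bessel_equation.

Section bessel_moment_equation.
Context {R : realType}.
Implicit Types (x y v t s : R) (n : nat).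
Local Notation mu := (@lebesgue_measure R).

(** The integrand is the derivative of the even function
    - exp (- x cosh s) / x. *)
Lemma Rintegral_odd_gauss x : 0 < x ->
  mu.-integrable setT (EFin \o (fun v => v * expR (- (x * bcosh v)))) /\
  \int[mu]_v (v * expR (- (x * bcosh v))) = 0.
Proof.
move=> x0.
have cf : continuous (fun v => v * expR (- (x * bcosh v))).
  move=> v; apply: cvgM; first exact: cvg_id.
  apply: (@continuous_comp _ _ _ (fun v => - (x * bcosh v))); last exact: continuous_expR.
  by apply: cvgN; apply: cvgMl_tmp; exact: continuous_bcosh.
have intf : mu.-integrable setT (EFin \o (fun v => v * expR (- (x * bcosh v)))).
  apply: le_integrable (integrable_bessel_integrand 2 x0) => //.
    by apply/measurable_EFinP; exact: continuous_measurable_fun.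
  move=> v _ /=; rewrite lee_fin normrM (ger0_norm (expR_ge0 _)).
  rewrite (ger0_norm (bessel_integrand_ge0 _ _ _)).
  rewrite /bessel_integrand ler_pM2r ?expR_gt0// ler_pdivlMr ?bhcosh_gt0//.
  apply: (le_trans (normM_bhcosh_le_bcosh v)).
  by rewrite expr2 ler_peMl ?bcosh_ge1// ltW// bcosh_gt0.
split => //.
apply: (@Rintegral_derivative_eq0 _ (fun v => - x^-1 * expR (- (x * bcosh v)))) => //.
- move=> v; have ? := is_derive_bcosh v; apply: is_derive_eq.
  by rewrite /GRing.scale/= ?mul0r ?mulr0 ?addr0 ?add0r; field; rewrite gt_eqF.
- rewrite (_ : (fun n : nat => _) = cst 0); first exact: cvg_cst.
  by apply/funext => n; rewrite /bcosh sqrrN subrr.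
Qed.

(** The derivatives of [bessel_moment 1] are, up to sign, the next moments, so
    this is the Bessel equation of order 1. Under the integral sign, the left-hand
    side times ds is the differential of - (x cosh s + 1) sinh s exp (- x cosh s),
    which vanishes at both ends. *)
Lemma bessel_moment_ode x : 0 < x ->
  x ^+ 2 * bessel_moment 3 x - x * bessel_moment 2 x
    - (x ^+ 2 + 1) * bessel_moment 1 x = 0 :> R.
Proof.
move=> x0.
pose f v := x ^+ 2 * bessel_integrand 3 x v - x * bessel_integrand 2 x v
  - (x ^+ 2 + 1) * bessel_integrand 1 x v.
(* the primitive above, with sinh s = v cosh (s / 2) *)
pose F v := - ((x * bcosh v + 1) * (v * bhcosh v) * expR (- (x * bcosh v))).
have i1 c n : mu.-integrable setT (EFin \o (fun v => c * bessel_integrand n x v)).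
  have := integrable_bessel_integrand n x0.
  move=> /(@integrableZl _ _ _ mu setT measurableT c).
  by apply: eq_integrable => // v _ /=; rewrite EFinM.
have i2 : mu.-integrable setT (EFin \o (fun v =>
    x ^+ 2 * bessel_integrand 3 x v - x * bessel_integrand 2 x v)).
  have := @integrableB _ _ _ mu setT measurableT _ _ (i1 (x ^+ 2) 3) (i1 x 2).
  by apply: eq_integrable => // v _ /=; rewrite EFinB.
have intf : mu.-integrable setT (EFin \o f).
  have := @integrableB _ _ _ mu setT measurableT _ _ i2 (i1 (x ^+ 2 + 1) 1).
  by apply: eq_integrable => // v _ /=; rewrite EFinB.
have dF v : is_derive v 1 F (f v).
  rewrite /F; have ? := is_derive_bcosh v; have ? := is_derive_bhcosh v.
  apply: is_derive_eq.
  have q0 := bhcosh_gt0 v; have q2 := bhcosh_sqr v.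
  rewrite /f /bessel_integrand /GRing.scale/= ?mul0r ?mulr0 ?addr0 ?add0r ?mulr1.
  set e := expR _; move: q0 q2; set q := bhcosh v; rewrite /bcosh => q0 q2.
  have qn : q != 0 by rewrite gt_eqF.
  apply: (mulIf qn).
  (* clearing the denominator q leaves a polynomial identity modulo q ^ 2 *)
  transitivity (- e * (- (x * (1 + v ^+ 2 / 2) + 1) * x * v ^+ 2 * q ^+ 2
      + (x * (1 + v ^+ 2 / 2) + 1) * (v ^+ 2 / 4 + q ^+ 2)
      + x * v ^+ 2 * q ^+ 2)); first by field.
  by rewrite q2; field.
have cf : continuous f.
  move=> v; apply: cvgB; first apply: cvgB.
  - by apply: cvgMl_tmp; exact: continuous_bessel_integrand.
  - by apply: cvgMl_tmp; exact: continuous_bessel_integrand.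
  - by apply: cvgMl_tmp; exact: continuous_bessel_integrand.
have := Rintegral_derivative_eq0 dF cf intf.
rewrite /f RintegralB// RintegralB// !RintegralZl//;
  [|exact: integrable_bessel_integrand..].
rewrite /bessel_moment => h.
apply: (@mulfI _ 2) => //; rewrite mulr0 -[RHS]h; first by field.
rewrite (_ : (fun n : nat => _) = (fun n => 2 * F n%:R)); last first.
  by apply/funext => n; rewrite /F /bcosh /bhcosh sqrrN; ring.
rewrite -(mulr0 2); apply: cvgMl_tmp.
rewrite -oppr0; apply: cvgN.
pose G m := x * (bcosh (m%:R : R) ^+ 2 * expR (- (x * bcosh m%:R)))
  + bcosh m%:R ^+ 1 * expR (- (x * bcosh m%:R)).
apply: (@squeeze_cvgr _ _ _ _ (cst 0) G).
- apply: nearW => m /=; have h1 := bcosh_gt0 (m%:R : R).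
  have h2 := bhcosh_gt0 (m%:R:R).
  have e0 := expR_gt0 (- (x * bcosh (m%:R : R))).
  have m0 := ler0n R m.
  rewrite !mulr_ge0 ?addr_ge0 ?mulr_ge0 ?(ltW x0) ?(ltW h1) ?(ltW h2) ?(ltW e0)//=.
  have := normM_bhcosh_le_bcosh (m%:R : R); rewrite ger0_norm// => hq.
  have -> : G m = (x * bcosh m%:R + 1) * bcosh m%:R * expR (- (x * bcosh m%:R)).
    by rewrite /G; ring.
  rewrite ler_pM2r// ler_pM2l// addr_gt0// mulr_gt0//.
- exact: cvg_cst.
- rewrite -(addr0 (0:R)); apply: cvgD; last exact: cvg_bcoshX.
  by rewrite -(mulr0 x); apply: cvgMl_tmp; exact: cvg_bcoshX.
Qed.

End bessel_moment_equation.

(** * Asymptotics at infinity *)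

Section bessel_asymptotics.
Context {R : realType}.
Implicit Types (x y v t s : R) (n : nat).
Local Notation mu := (@lebesgue_measure R).

(** The centred normal density of variance 1 / y: its exponent is the Gaussian
    part of the Bessel integrand at parameter [y]. *)
Definition gauss_density y v : R := normal_pdf 0 (Num.sqrt y^-1) v.
Definition gauss_peak y : R := normal_peak (Num.sqrt y^-1).

Lemma gauss_peak_gt0 y : 0 < y -> 0 < gauss_peak y.
Proof. by move=> y0; rewrite normal_peak_gt0// gt_eqF// sqrtr_gt0 invr_gt0. Qed.

Lemma gauss_densityE y v : 0 < y ->
  gauss_density y v = gauss_peak y * expR (- (y / 2 * v ^+ 2)).
Proof.
move=> y0; rewrite /gauss_density normal_pdfE ?gt_eqF ?sqrtr_gt0 ?invr_gt0//.
congr (_ * expR _).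
by rewrite sqr_sqrtr ?invr_ge0 ?ltW// subr0 -mulr_natr; field; rewrite gt_eqF.
Qed.

Lemma gauss_peakE y : 0 < y -> (gauss_peak y)^-1 = Num.sqrt (2 * pi / y).
Proof.
move=> y0; rewrite /gauss_peak /normal_peak invrK sqr_sqrtr ?invr_ge0 ?ltW//.
by congr Num.sqrt; rewrite -mulr_natr; field; rewrite gt_eqF.
Qed.

Lemma integrable_gauss_density y : mu.-integrable setT (EFin \o gauss_density y).
Proof. exact: integrable_normal_pdf. Qed.

Lemma Rintegral_gauss_density y : \int[mu]_v gauss_density y v = 1.
Proof. by rewrite /Rintegral integral_normal_pdf. Qed.

Definition bessel_asymptote x : R := Num.sqrt (pi / (2 * x)) * expR (- x).

Lemma bessel_asymptoteE x : 0 < x ->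
  bessel_asymptote x = 2^-1 * (expR (- x) / gauss_peak x).
Proof.
move=> x0; rewrite /bessel_asymptote gauss_peakE// mulrCA mulrC; congr (_ * _).
have p0 := pi_ge0 R.
have -> : Num.sqrt (2 * pi / x) = Num.sqrt (2 ^+ 2 * (pi / (2 * x))).
  by congr Num.sqrt; field; rewrite gt_eqF.
by rewrite (sqrtrM _ (sqr_ge0 2)) sqrtr_sqr ger0_norm// mulKf.
Qed.

Lemma bessel_asymptote_gt0 x : 0 < x -> 0 < bessel_asymptote x.
Proof.
move=> x0; rewrite bessel_asymptoteE// mulr_gt0 ?invr_gt0//.
by rewrite divr_gt0 ?expR_gt0 ?gauss_peak_gt0.
Qed.

Lemma bessel_integrand_gauss x v : 0 < x ->
  bessel_integrand 1 x v =
    expR (- x) / gauss_peak x * (bcosh v / bhcosh v * gauss_density x v).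
Proof.
move=> x0; rewrite gauss_densityE// /bessel_integrand expr1.
have -> : - (x * bcosh v) = - x + - (x / 2 * v ^+ 2) by rewrite /bcosh; field.
rewrite expRD; by field; rewrite !gt_eqF ?gauss_peak_gt0 ?bhcosh_gt0.
Qed.

Lemma integrable_weighted_gauss x : 0 < x ->
  mu.-integrable setT (EFin \o (fun v => bcosh v / bhcosh v * gauss_density x v)).
Proof.
move=> x0; have := integrable_bessel_integrand 1 x0.
move=> /(@integrableZl _ _ _ mu setT measurableT (gauss_peak x / expR (- x))).
apply: eq_integrable => // v _ /=; rewrite -EFinM bessel_integrand_gauss//; congr EFin.
by field; rewrite !gt_eqF ?gauss_peak_gt0 ?expR_gt0 ?bhcosh_gt0.
Qed.

(** As x cosh s = x + x v^2 / 2, the ratio to the expected asymptote is the mean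
    of cosh s / cosh (s / 2) under the centred normal law of variance 1 / x. *)
Lemma bessel_ratioE x : 0 < x ->
  bessel_moment 1 x / bessel_asymptote x =
    \int[mu]_v (bcosh v / bhcosh v * gauss_density x v).
Proof.
move=> x0; rewrite /bessel_moment bessel_asymptoteE//.
rewrite (_ : \int[mu]_v bessel_integrand 1 x v =
    expR (- x) / gauss_peak x * \int[mu]_v (bcosh v / bhcosh v * gauss_density x v)).
  by field; rewrite !gt_eqF ?gauss_peak_gt0 ?expR_gt0.
rewrite -RintegralZl//; last exact: integrable_weighted_gauss.
by apply: eq_Rintegral => v _; rewrite bessel_integrand_gauss.
Qed.

Lemma bcosh_ratio_ge1 v : 1 <= bcosh v / bhcosh v.
Proof. by rewrite ler_pdivlMr ?bhcosh_gt0// mul1r bhcosh_le_bcosh. Qed.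

Lemma bessel_ratio_ge1 x : 0 < x -> 1 <= bessel_moment 1 x / bessel_asymptote x.
Proof.
move=> x0; rewrite bessel_ratioE// -(Rintegral_gauss_density x); apply: le_Rintegral => //.
- exact: integrable_gauss_density.
- exact: integrable_weighted_gauss.
by move=> v _; rewrite ler_peMl ?normal_pdf_ge0// bcosh_ratio_ge1.
Qed.

Lemma bessel_moment1_gt0 x : 0 < x -> 0 < bessel_moment 1 x.
Proof.
move=> x0; have := bessel_ratio_ge1 x0; rewrite ler_pdivlMr ?bessel_asymptote_gt0// mul1r.
by apply: lt_le_trans; exact: bessel_asymptote_gt0.
Qed.

(** Here cosh s / cosh (s / 2) <= 1 + v^2 / 2, and v^2 exp (- x v^2 / 2) is at
    most (4 / x) exp (- x v^2 / 4); the excess over 1 is therefore at most 4 / x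
    times a normal density of twice the variance. *)
Lemma bessel_ratio_le x : 0 < x ->
  bessel_moment 1 x / bessel_asymptote x <= 1 + 4 / x.
Proof.
move=> x0; have x20 : 0 < x / 2 by rewrite divr_gt0.
have i2 : mu.-integrable setT (EFin \o (fun v => 4 / x * gauss_density (x / 2) v)).
  have := integrable_gauss_density (x / 2).
  move=> /(@integrableZl _ _ _ mu setT measurableT (4 / x)).
  by apply: eq_integrable => // v _ /=; rewrite EFinM.
have i3 : mu.-integrable setT (EFin \o (fun v =>
    gauss_density x v + 4 / x * gauss_density (x / 2) v)).
  have := @integrableD _ _ _ mu setT measurableT _ _ (integrable_gauss_density x) i2.
  by apply: eq_integrable => // v _ /=; rewrite EFinD.
have -> : 1 + 4 / x = \int[mu]_v (gauss_density x v + 4 / x * gauss_density (x / 2) v).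
  rewrite RintegralD//; last exact: integrable_gauss_density.
  rewrite RintegralZl//; last exact: integrable_gauss_density.
  by rewrite !Rintegral_gauss_density mulr1.
rewrite bessel_ratioE//; apply: le_Rintegral => //; first exact: integrable_weighted_gauss.
move=> v _; rewrite !gauss_densityE//.
have hp : gauss_peak x <= 2 * gauss_peak (x / 2).
  rewrite -(invrK (gauss_peak (x / 2))) -(invrK (gauss_peak x)) !gauss_peakE//.
  have s0 : 0 < Num.sqrt (2 * pi / x) by rewrite sqrtr_gt0 !mulr_gt0 ?invr_gt0 ?pi_gt0.
  have s1 : 0 < Num.sqrt (2 * pi / (x / 2)) by rewrite sqrtr_gt0 !mulr_gt0 ?invr_gt0 ?pi_gt0.
  rewrite ler_pdivlMr// mulrC ler_pdivrMr//.
  have -> : 2 * pi / (x / 2) = 2 * (2 * pi / x) :> R by field; rewrite gt_eqF.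
  rewrite sqrtrM// ler_pM2r//.
  rewrite -[leRHS]ger0_norm// -sqrtr_sqr ler_sqrt ?sqr_ge0// expr2; lra.
have hq : bcosh v / bhcosh v <= bcosh v.
  by rewrite ler_pdivrMr ?bhcosh_gt0// ler_peMr ?bhcosh_ge1// ltW// bcosh_gt0.
set e := expR (- (x / 2 / 2 * v ^+ 2)).
have -> : expR (- (x / 2 * v ^+ 2)) = e * e.
  by rewrite /e -expRD; congr expR; field.
have e0 : 0 < e by exact: expR_gt0.
have he : x / 4 * v ^+ 2 * e <= 1.
  have -> : 1 = 1`!%:R :> R by [].
  have := @powXexpR_le R 1 (x / 4 * v ^+ 2); rewrite expr1.
  have -> : - (x / 4 * v ^+ 2) = - (x / 2 / 2 * v ^+ 2) by field.
  by apply; rewrite mulr_ge0 ?sqr_ge0// divr_ge0// ltW.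
have g0 := gauss_peak_gt0 x0; have g20 := gauss_peak_gt0 x20.
apply: (@le_trans _ _ (bcosh v * (gauss_peak x * (e * e)))).
  by rewrite ler_wpM2r// !mulr_ge0 ?ltW.
rewrite /bcosh mulrDl mul1r lerD2l.
have -> : v ^+ 2 / 2 * (gauss_peak x * (e * e)) =
    2 / x * gauss_peak x * e * (x / 4 * v ^+ 2 * e).
  by field; rewrite gt_eqF.
have -> : 4 / x * (gauss_peak (x / 2) * e) = 2 / x * (2 * gauss_peak (x / 2)) * e * 1.
  by field; rewrite gt_eqF.
apply: ler_pM => //.
- by apply/ltW; rewrite mulr_gt0// mulr_gt0// divr_gt0.
- by rewrite mulr_ge0 ?(ltW e0)// mulr_ge0 ?sqr_ge0// divr_ge0// ltW.
by rewrite ler_pM2r// ler_pM2l// divr_gt0.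
Qed.

Lemma bessel_ratio_cvg :
  bessel_moment 1 x / bessel_asymptote x @[x --> +oo] --> (1 : R).
Proof.
apply: (@squeeze_cvgr _ _ _ _ (cst 1) (fun x => 1 + 4 / x)).
- near=> x; have x0 : 0 < x by near: x; exact: nbhs_pinfty_gt.
  by rewrite bessel_ratio_ge1// bessel_ratio_le.
- exact: cvg_cst.
- rewrite -[X in _ --> X]addr0; apply: cvgD; first exact: cvg_cst.
  rewrite -(mulr0 4); apply: cvgMl_tmp; apply/gtr0_cvgV0; last exact: cvg_id.
  exact: nbhs_pinfty_gt.
Unshelve. all: end_near. Qed.

Lemma derive1_bessel_moment n x : 0 < x ->
  derive1 (bessel_moment n) x = - bessel_moment n.+1 x :> R.
Proof.
by move=> x0; have ? := is_derive_bessel_moment n x0; rewrite derive1E derive_val.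
Qed.

Lemma is_besselK_bessel_moment1 : is_besselK 1 (@bessel_moment R 1).
Proof.
split; last exact: bessel_ratio_cvg.
move=> x x0.
have D2 : is_derive x 1 (derive1 (bessel_moment 1)) (bessel_moment 3 x).
  apply: (@near_eq_is_derive _ _ _ (fun y => - bessel_moment 2 y)) => //; last first.
    have ? := is_derive_bessel_moment 2 x0; apply: is_derive_eq.
    by rewrite opprK.
  near=> y; rewrite derive1_bessel_moment//; near: y; exact: lt_nbhsr.
split.
- by have [] := is_derive_bessel_moment 1 x0.
- by have [] := D2.
rewrite [derive1 (derive1 _) x]derive1E derive_val derive1_bessel_moment// mulrN.
by rewrite expr1n bessel_moment_ode.
Unshelve. all: end_near. Qed.

End bessel_asymptotics.

(** * Uniqueness of the Macdonald function *)

Section bessel_uniqueness.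
Context {R : realType}.
Implicit Types (x y v t s : R) (n : nat).
Local Notation mu := (@lebesgue_measure R).

Lemma derive_eq0_pos_cst (f : R -> R) : (forall x, 0 < x -> is_derive x 1 f 0) ->
  forall x y, 0 < x -> 0 < y -> f x = f y.
Proof.
move=> df x y; wlog xy : x y / x <= y.
  by move=> H x0 y0; case: (leP x y) => [xy|/ltW yx]; [exact: H|apply/esym/H].
move=> x0 _.
have pos z : z \in `[x, y] -> 0 < z by rewrite in_itv/= => /andP[/(lt_le_trans x0)].
have [] := @MVT_segment _ f (fun=> 0) x y xy.
- by move=> z /subset_itv_oo_cc/pos/df.
- apply: derivable_within_continuous => z /pos/df.
  by case.
- by move=> z _; rewrite mul0r => /eqP; rewrite subr_eq0 => /eqP.
Qed.

Lemma derivable_is_derive1 (f : R -> R) x :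
  derivable f x 1 -> is_derive x 1 f (derive1 f x).
Proof. by move=> d; apply: DeriveDef => //; rewrite derive1E. Qed.

(** By Abel's identity, x times the Wronskian of the two solutions is a constant
    C, so (L / K)' = C / (x K^2). The common asymptotics make x K^2 bounded at
    infinity while L / K tends to 1, which forces C = 0; then L / K is constant,
    equal to its limit 1. *)
Lemma is_besselK_unique (nu : R) (K L : R -> R) :
  is_besselK nu K -> is_besselK nu L -> (forall x, 0 < x -> 0 < K x) ->
  forall x, 0 < x -> L x = K x.
Proof.
move=> [odeK limK] [odeL limL] K0.
have dK x : 0 < x -> is_derive x 1 K (derive1 K x).
  by move=> /odeK[d _ _]; exact: derivable_is_derive1.
have dK' x : 0 < x -> is_derive x 1 (derive1 K) (derive1 (derive1 K) x).
  by move=> /odeK[_ d _]; exact: derivable_is_derive1.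
have dL x : 0 < x -> is_derive x 1 L (derive1 L x).
  by move=> /odeL[d _ _]; exact: derivable_is_derive1.
have dL' x : 0 < x -> is_derive x 1 (derive1 L) (derive1 (derive1 L) x).
  by move=> /odeL[_ d _]; exact: derivable_is_derive1.
pose W x := x * (derive1 L x * K x - L x * derive1 K x).
have dW x : 0 < x -> is_derive x 1 W 0.
  move=> x0; rewrite /W.
  have ? := dK _ x0; have ? := dK' _ x0; have ? := dL _ x0; have ? := dL' _ x0.
  apply: is_derive_eq; rewrite /GRing.scale/=.
  have [_ _ eK] := odeK _ x0; have [_ _ eL] := odeL _ x0.
  move: eK eL; set K2 := derive1 (derive1 K) x; set L2 := derive1 (derive1 L) x.
  set K1 := derive1 K x; set L1 := derive1 L x => eK eL.
  have xn : x != 0 by rewrite gt_eqF.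
  apply: (mulfI xn); rewrite mulr0.
  transitivity (K x * (x ^+ 2 * L2 + x * L1 - (x ^+ 2 + nu ^+ 2) * L x)
    - L x * (x ^+ 2 * K2 + x * K1 - (x ^+ 2 + nu ^+ 2) * K x)); first by ring.
  by rewrite eK eL !mulr0 subr0.
pose r x := L x / K x.
have dr x : 0 < x -> is_derive x 1 r (W 1 / (x * K x ^+ 2)).
  move=> x0; rewrite (derive_eq0_pos_cst dW ltr01 x0) /r.
  have Kn : K x != 0 by rewrite gt_eqF// K0.
  have ? := dK _ x0; have ? := dL _ x0; apply: is_derive_eq.
  rewrite /GRing.scale/= /W; field.
  by rewrite Kn gt_eqF.
have limr : r x @[x --> +oo] --> (1 : R).
  rewrite -(divr1 (1 : R)).
  apply: cvg_trans (cvgM limL (cvgV (oner_neq0 R) limK)).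
  apply: near_eq_cvg; near=> x; have x0 : 0 < x by near: x; exact: nbhs_pinfty_gt.
  rewrite /r /=; field; rewrite gt_eqF ?K0//=.
  by rewrite !gt_eqF ?expR_gt0// sqrtr_gt0 divr_gt0 ?pi_gt0// mulr_gt0.
have C0 : W 1 = 0.
  apply/eqP/negPn/negP => Cn.
  have [M M0 HM] : exists2 M, 0 < M & forall x, M <= x ->
      `|r x - 1| <= 1 /\ K x / (Num.sqrt (pi / (2 * x)) * expR (- x)) <= 2.
    have [M1 [_ H1]] : \forall x \near +oo, `|r x - 1| <= 1 /\
        K x / (Num.sqrt (pi / (2 * x)) * expR (- x)) <= 2.
      near=> x; split.
        by rewrite distrC; near: x; move/cvgrPdist_le : limr; apply.
      by near: x; apply: (cvgr_le _ limK); rewrite ltr1n.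
    exists (Num.max 1 M1 + 1).
      by rewrite ltr_pwDr// le_max ler01.
    move=> x Mx; apply: H1; apply: lt_le_trans Mx.
    by rewrite ltr_pwDr// le_max lexx orbT.
  have P0 : 0 < 2 * pi :> R by rewrite mulr_gt0 ?pi_gt0.
  have bK x : M <= x -> x * K x ^+ 2 <= 2 * pi.
    move=> Mx; have x0 := lt_le_trans M0 Mx; have [_] := HM _ Mx.
    have p0 : 0 <= pi / (2 * x) by rewrite divr_ge0 ?pi_ge0// mulr_ge0// ltW.
    have s0 : 0 < Num.sqrt (pi / (2 * x)) * expR (- x).
      by rewrite mulr_gt0 ?expR_gt0// sqrtr_gt0 divr_gt0 ?pi_gt0// mulr_gt0.
    rewrite ler_pdivrMr// => h.
    have h2 : K x ^+ 2 <= (2 * (Num.sqrt (pi / (2 * x)) * expR (- x))) ^+ 2.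
      by rewrite ler_pXn2r// nnegrE ltW ?K0// mulr_gt0.
    rewrite -ler_pdivlMl//; apply: (le_trans h2).
    rewrite !exprMn sqr_sqrtr//.
    have e1 : expR (- x) ^+ 2 <= 1.
      by rewrite expr_le1 ?expR_ge0// expR_le1 oppr_le0 ltW.
    apply: (@le_trans _ _ (2 ^+ 2 * (pi / (2 * x) * 1))).
      by rewrite ler_pM2l ?exprn_gt0// ler_wpM2l.
    by rewrite le_eqVlt; apply/orP; left; apply/eqP; field; rewrite gt_eqF.
  (* an interval [M, M + y] so long that L / K would vary by at least 3 over it, although
     L / K stays within 1 of its limit beyond M *)
  pose y := 3 * (2 * pi) / `|W 1|.
  have C1 : 0 < `|W 1| by rewrite normr_gt0.
  have y0 : 0 < y by rewrite divr_gt0// mulr_gt0.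
  have My : M < M + y by rewrite ltrDl.
  have [| |c cM rE] := @MVT_segment _ r (fun x => W 1 / (x * K x ^+ 2)) _ _ (ltW My).
  - move=> z; rewrite in_itv/= => /andP[Mz _]; apply: dr; exact: lt_trans Mz.
  - apply: derivable_within_continuous => z; rewrite in_itv/= => /andP[Mz _].
    by have [] := dr z (lt_le_trans M0 Mz).
  have Mc : M <= c by move: cM; rewrite in_itv/= => /andP[].
  have c0 := lt_le_trans M0 Mc.
  have [r1 _] := HM _ (lexx M); have [r2 _] := HM _ (ltW My).
  have : `|r (M + y) - r M| <= 2.
    rewrite -(subrKA 1) (le_trans (ler_normD _ _))//.
    by rewrite (distrC 1) (_ : 2 = 1 + 1)// lerD.
  rewrite rE addrC addKr normrM (ger0_norm (ltW y0)) normrM normfV.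
  have cK : 0 < c * K c ^+ 2 by rewrite mulr_gt0// exprn_gt0// K0.
  rewrite (gtr0_norm cK) => le2.
  have : `|W 1| / (2 * pi) * y <= 2.
    apply: le_trans le2; rewrite ler_pM2r// ler_pM2l// lef_pV2 ?posrE//.
    exact: bK.
  have cancel3 (a b : R) : a != 0 -> b != 0 -> b / a * (3 * a / b) = 3.
    by move=> a0 b0; field; rewrite b0.
  by rewrite /y cancel3 ?lt0r_neq0// leNgt ltr_nat.
move=> x x0; have dr0 (z : R) : 0 < z -> is_derive z 1 r 0.
  by move=> /dr; rewrite C0 mul0r.
have rx : r z @[z --> +oo] --> r x.
  apply: cvg_near_cst; near=> z; apply: (derive_eq0_pos_cst dr0 _ x0).
  by near: z; exact: nbhs_pinfty_gt.
have r1 : r x = 1 by exact: (cvg_unique _ rx limr).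
by rewrite -[LHS](@divfK _ (K x)) ?gt_eqF ?K0// -/(r x) r1 mul1r.
Unshelve. all: end_near. Qed.

Lemma besselK1E x : 0 < x -> besselK 1 x = bessel_moment 1 x :> R.
Proof.
apply: (@is_besselK_unique 1) => //.
- exact: is_besselK_bessel_moment1.
- rewrite /besselK; apply: (@xgetPex _ _ [set K : R -> R | is_besselK 1 K]).
  by exists (bessel_moment 1); exact: is_besselK_bessel_moment1.
- exact: bessel_moment1_gt0.
Qed.

End bessel_uniqueness.

(** * An integral representation of K_1 *)

Section bessel_representation.
Context {R : realType}.
Implicit Types (x y v t s : R) (n : nat).
Local Notation mu := (@lebesgue_measure R).

(** This sum is exp (s / 2) = sinh (s / 2) + cosh (s / 2). *)
Lemma half_bhcosh_gt0 v : 0 < v / 2 + bhcosh v.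
Proof.
have q0 := bhcosh_gt0 v; have q2 := bhcosh_sqr v; rewrite ltNge; apply/negP => h.
have : 0 <= (- (v / 2) - bhcosh v) * (- (v / 2) + bhcosh v) by apply: mulr_ge0; lra.
have -> : (- (v / 2) - bhcosh v) * (- (v / 2) + bhcosh v) = v ^+ 2 / 4 - bhcosh v ^+ 2 by field.
by rewrite q2; lra.
Qed.

Lemma bcosh_sub_inv s : 0 < s -> bcosh (s - s^-1) = (s ^+ 2 + s^-1 ^+ 2) / 2.
Proof. by move=> s0; rewrite /bcosh; field; rewrite gt_eqF. Qed.

Lemma bhcosh_sub_inv s : 0 < s -> bhcosh (s - s^-1) = (s + s^-1) / 2.
Proof.
move=> s0; have h : 0 < (s + s^-1) / 2 by rewrite divr_gt0// addr_gt0// invr_gt0.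
rewrite -[RHS]ger0_norm ?ltW// -sqrtr_sqr /bhcosh; congr Num.sqrt.
by field; rewrite gt_eqF.
Qed.

(** With r = b / a and r t = exp s, that is v = sqrt (r t) - 1 / sqrt (r t), the
    exponent becomes - a b cosh s, and t^-2 dt becomes
    r (cosh s / cosh (s / 2) - v) dv. The term in v is odd and integrates to 0;
    the other one gives 2 r K_1 (a b). *)
Lemma integral_inv_sqr_expR (a b : R) : 0 < a -> 0 < b ->
  (\int[mu]_(t in `]0%R, +oo[)
      (t^-1 ^+ 2 * expR (- ((a ^+ 2 / t + b ^+ 2 * t) / 2)))%:E
   = (2 * (b / a) * bessel_moment 1 (a * b))%:E)%E.
Proof.
move=> a0 b0; pose r := b / a; have r0 : 0 < r by rewrite divr_gt0.
have x0 : 0 < a * b by rewrite mulr_gt0.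
pose psi t := Num.sqrt (r * t) - (Num.sqrt (r * t))^-1.
pose phi v := (v / 2 + bhcosh v) ^+ 2 / r.
pose w t := (r * t + 1) / (2 * t * Num.sqrt (r * t)).
pose g v := r * bessel_integrand 1 (a * b) v - r * (v * expR (- (a * b * bcosh v))).
have bqi v : (v / 2 + bhcosh v)^-1 = bhcosh v - v / 2.
  have h := lt0r_neq0 (half_bhcosh_gt0 v); apply: (mulIf h).
  have -> : (bhcosh v - v / 2) * (v / 2 + bhcosh v) = bhcosh v ^+ 2 - v ^+ 2 / 4 by field.
  by rewrite mulVf// bhcosh_sqr addrK.
have s0 t : 0 < t -> 0 < Num.sqrt (r * t) by move=> t0; rewrite sqrtr_gt0 mulr_gt0.
have s2 t : 0 < t -> Num.sqrt (r * t) ^+ 2 = r * t.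
  by move=> t0; rewrite sqr_sqrtr// mulr_ge0 ?ltW.
have [iv Iv] := Rintegral_odd_gauss x0.
have ik := integrable_bessel_integrand 1 x0.
have i1 : mu.-integrable setT (EFin \o (fun v => r * bessel_integrand 1 (a * b) v)).
  move: ik => /(@integrableZl _ _ _ mu setT measurableT r).
  by apply: eq_integrable => // v _ /=; rewrite EFinM.
have i2 : mu.-integrable setT (EFin \o (fun v => r * (v * expR (- (a * b * bcosh v))))).
  move: iv => /(@integrableZl _ _ _ mu setT measurableT r).
  by apply: eq_integrable => // v _ /=; rewrite EFinM.
have ig : mu.-integrable setT (EFin \o g).
  have := @integrableB _ _ _ mu setT measurableT _ _ i1 i2.
  by apply: eq_integrable => // v _ /=; rewrite EFinB.
have gE v : g v = r * (bcosh v / bhcosh v - v) * expR (- (a * b * bcosh v)).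
  by rewrite /g /bessel_integrand expr1; field; rewrite gt_eqF ?bhcosh_gt0.
have g0 v : 0 <= g v.
  rewrite gE mulr_ge0 ?expR_ge0// mulr_ge0 ?(ltW r0)// subr_ge0.
  rewrite ler_pdivlMr ?bhcosh_gt0//; apply: le_trans (normM_bhcosh_le_bcosh v).
  by rewrite ler_pM2r ?bhcosh_gt0// ler_norm.
have <- : (\int[mu]_v (EFin \o g) v = (2 * (b / a) * bessel_moment 1 (a * b))%:E)%E.
  rewrite -[LHS]fineK; last exact: integrable_fin_num.
  rewrite -[fine _]/(\int[mu]_v g v)%R RintegralB// !RintegralZl// Iv mulr0 subr0.
  by congr EFin; rewrite /bessel_moment /r; field; rewrite gt_eqF.
transitivity (\int[mu]_(t in `]0%R, +oo[) ((EFin \o g) (psi t) * (w t)%:E))%E;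
  last first.
  apply/esym/(@ge0_integral_substitution_pos R psi phi w).
- by move=> v; rewrite divr_gt0// exprn_gt0// half_bhcosh_gt0.
- move=> v; rewrite /psi /phi mulrC divfK ?gt_eqF// sqrtr_sqr gtr0_norm ?half_bhcosh_gt0//.
  by rewrite bqi; field.
- move=> x y x0' xy; rewrite /psi ltrB//.
    by rewrite ltr_sqrt ?ltr_pM2l// mulr_gt0// (lt_trans x0').
  rewrite ltf_pV2 ?posrE ?s0// ?(lt_trans x0')//.
  by rewrite ltr_sqrt ?ltr_pM2l// mulr_gt0// (lt_trans x0').
- move=> t t0.
  have dsq : is_derive t 1 (fun z => Num.sqrt (r * z)) (r / (2 * Num.sqrt (r * t))).
    have p : 0 < r * t by rewrite mulr_gt0.
    have ? := is_derive1_sqrt p.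
    have -> : (fun z : R => Num.sqrt (r * z)) = Num.sqrt \o (fun z => r * z) by [].
    apply: is_derive_eq.
    by rewrite /GRing.scale/= ?scaler0 ?addr0 ?add0r ?mulr1 mulrC.
  have sn : Num.sqrt (r * t) != 0 by rewrite gt_eqF ?s0.
  have dV := @is_deriveV _ (fun z : R => Num.sqrt (r * z)) t _ 1 sn dsq.
  rewrite /psi; apply: is_derive_eq.
  have tE : t = Num.sqrt (r * t) ^+ 2 / r by rewrite s2// mulrC mulKf ?gt_eqF.
  rewrite /w /GRing.scale/=; move: sn tE (s2 _ t0).
  set s := Num.sqrt (r * t) => sn tE <-.
  by rewrite [in RHS]tE; field; rewrite sn gt_eqF.
- move=> t t0.
  have c1 : {for t, continuous (fun t => Num.sqrt (r * t))}.
    apply: (@continuous_comp _ _ _ (fun t => r * t)); last exact: sqrt_continuous.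
    by apply: cvgMl_tmp; exact: cvg_id.
  apply: cvgM.
    apply: cvgD; last exact: cvg_cst.
    by apply: cvgMl_tmp; exact: cvg_id.
  apply: cvgV; first by rewrite !mulf_neq0 ?gt_eqF ?s0.
  apply: cvgM; last exact: c1.
  by apply: cvgMl_tmp; exact: cvg_id.
- move=> t t0; have rt : 0 < r * t by rewrite mulr_gt0.
  by apply: divr_ge0; [lra|rewrite mulr_ge0 ?sqrtr_ge0// mulr_ge0// ltW].
- exact: (measurable_int mu).
- by move=> v; rewrite lee_fin.
- apply: eq_integral => t; rewrite inE/= in_itv/= andbT => t0.
  rewrite -EFinM; congr EFin; rewrite gE /psi.
  have st0 := s0 _ t0; have st2 := s2 _ t0.
  rewrite /w; move: st0 st2; set s := Num.sqrt (r * t) => st0 st2.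
  have sn : s != 0 by rewrite gt_eqF.
  have tE : t = s ^+ 2 / r by rewrite st2 mulrC mulKf ?gt_eqF.
  rewrite -st2 bcosh_sub_inv// bhcosh_sub_inv// tE [RHS]mulrAC.
  congr (_ * expR _).
  + by field; rewrite sn !gt_eqF//= ?addr_gt0 ?mulr_gt0.
  + by rewrite /r; field; rewrite sn !gt_eqF.
Qed.

End bessel_representation.

(** * Evaluating a process at an independent random time *)

Section independent_time.
Context {R : realType} {d : measure_display} {Omega : measurableType d}.
Variables (P : probability Omega R) (T : Omega -> R) (B : R -> Omega -> R).

(** The generators of [sigma_process]; the associated [g_sigma_algebraType] is
    the sample space equipped with the events of the process only. *)
Definition process_cylinders : set (set Omega) :=
  [set E | exists (t : R) (A : set R),
         [/\ 0 <= t, measurable A & E = B t @^-1` A] ].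

Local Notation Omega' := (g_sigma_algebraType process_cylinders).

Hypothesis mT : measurable_fun setT T.
Hypothesis mB : forall t : R, 0 <= t -> measurable_fun setT (B t).
Hypothesis cB : forall w, {within `[0, +oo[, continuous (fun t : R => B t w)}.
Hypothesis indep : independent_of_process P T B.

Lemma sigma_process_measurable (E : set Omega) : sigma_process B E -> measurable E.
Proof.
apply: smallest_sub; first exact: sigma_algebra_measurable.
move=> _ [t [A [t0 mA ->]]]; rewrite -[X in measurable X]setTI.
exact: mB.
Qed.

(** The same sample point, seen in the coarser measurable space. *)
Let toOmega' (w : Omega) : Omega' := w.

Let mtoOmega' : measurable_fun setT toOmega'.
Proof.
by move=> _ E mE; rewrite setTI; exact: sigma_process_measurable.
Qed.

Let timed (w : Omega) : R * Omega' := (T w, w).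

Let mtimed : measurable_fun setT timed.
Proof. exact: (measurable_fun_pair mT mtoOmega'). Qed.

HB.instance Definition _ := isMeasurableFun.Build _ _ _ _ T mT.
HB.instance Definition _ := isMeasurableFun.Build _ _ _ _ toOmega' mtoOmega'.
HB.instance Definition _ := isMeasurableFun.Build _ _ _ _ timed mtimed.

Lemma measurable_at_random_time (X : R * Omega' -> R) :
  measurable_fun setT X -> measurable_fun setT (fun w : Omega => X (T w, w)).
Proof. by move=> mX; exact: (measurableT_comp mX mtimed). Qed.

Lemma measurable_probability_at_time (X : R * Omega' -> R) (A : set R) :
  measurable_fun setT X -> measurable A ->
  measurable_fun setT (fun t => P [set w | A (X (t, w))]).
Proof.
move=> mX mA.
have mXA : measurable (X @^-1` A) by rewrite -[X in measurable X]setTI; exact: mX.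
have := measurable_fun_xsection (distribution P toOmega') mXA.
apply: eq_measurable_fun => t _ /=.
by rewrite /distribution /pushforward /= xsectionE.
Qed.

(** Independence means that the law of (T, path) is a product measure, since both
    agree on rectangles; the probability of an event is then the integral of the
    probabilities of its sections. *)
Lemma probability_at_random_time (f : R -> R) (X : R * Omega' -> R) (A : set R) :
  has_pdf P T f -> measurable_fun setT X -> measurable A ->
  P [set w | A (X (T w, w))] =
  (\int[lebesgue_measure]_t (P [set w | A (X (t, w))] * (f t)%:E))%E.
Proof.
move=> [_ mf f0 fE] mX mA.
have mXA : measurable (X @^-1` A) by rewrite -[X in measurable X]setTI; exact: mX.
transitivity (distribution P timed (X @^-1` A)); first by [].
rewrite -(@product_measure_unique _ _ _ _ _ (distribution P T)
  (distribution P toOmega') (distribution P timed))//.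
transitivity (\int[distribution P T]_t P [set w | A (X (t, w))])%E.
  rewrite /product_measure1 /=; apply: eq_integral => t _.
  by rewrite /distribution /pushforward /= xsectionE.
have mh := measurable_probability_at_time mX mA.
(* the identity passes from the measurable structure that carries Lebesgue
   measure to the default one on R, which has the same events *)
pose idR : measurableTypeR R -> R := id.
have midR : measurable_fun setT idR by move=> _ D mD; rewrite setTI.
transitivity (\int[pushforward (density_measure lebesgue_measure mf f0) idR]_t
    P [set w | A (X (t, w))])%E.
  by apply: eq_measure_integral => D mD _; exact: fE.
rewrite ge0_integral_pushforward// preimage_setT integral_density_measure//.
Qed.

(** Rounding the time down to the grid of step 1 / (n + 1) gives functions that
    are measurable, being defined piecewise on countably many rectangles; by
    continuity of the paths they converge pointwise. Negative times, at which the
    process is meaningless, are replaced by 0. *)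
Lemma measurable_continuous_process :
  measurable_fun setT (fun z : R * Omega' => B (Num.max z.1 0) z.2).
Proof.
pose s n (t : R) : R := (Num.truncn (n.+1%:R * Num.max t 0))%:R / n.+1%:R.
have s0 n t : 0 <= s n t by rewrite divr_ge0.
apply: (@measurable_fun_cvg _ (R * Omega')%type R setT
  (fun n z => B (s n z.1) z.2) (fun z => B (Num.max z.1 0) z.2)) => [n|].
- move=> _ A mA; rewrite setTI.
  rewrite [X in measurable X](_ : _ = \bigcup_k
     ([set t : R | (k%:R <= n.+1%:R * Num.max t 0 < k.+1%:R)] `*`
      ((B (k%:R / n.+1%:R) : Omega' -> R) @^-1` A))).
    apply: bigcup_measurable => k _; apply: measurableX.
      rewrite (_ : [set _ | _] = setT `&`
        (fun t : R => n.+1%:R * Num.max t 0) @^-1` `[k%:R, k.+1%:R[%classic).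
        have mf : measurable_fun setT (fun t : R => n.+1%:R * Num.max t 0).
          by apply: measurable_funM => //; exact: measurable_maxr.
        by apply: mf => //; exact: measurable_itv.
      by rewrite setTI; apply/seteqP; split => t /=; rewrite in_itv.
    by apply: sub_sigma_algebra; exists (k%:R / n.+1%:R), A; split => //; rewrite divr_ge0.
  have tn (t : R) : 0 <= n.+1%:R * Num.max t 0.
    by rewrite mulr_ge0// le_max lexx orbT.
  apply/seteqP; split => -[t w] /=.
    move=> h; exists (Num.truncn (n.+1%:R * Num.max t 0)) => //; split => //=.
    exact: truncn_itv.
  move=> [k _ [/= hk]]; rewrite /s (_ : Num.truncn _ = k)//.
  exact/truncn_def.
- move=> [t w] _ /=.
  have [t0|t0] := lerP t 0.
    apply: cvg_near_cst; apply: nearW => n; rewrite /s (max_idPr t0) mulr0 truncn0.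
    by rewrite mul0r.
  have st : s n t @[n --> \oo] --> t.
    apply: (@squeeze_cvgr _ _ _ _ (fun n => t - harmonic n) (cst t)).
    + apply: nearW => n /=; rewrite /s (max_idPl (ltW t0)).
      have n0 : 0 < n.+1%:R :> R by [].
      have /andP[h1] := truncn_itv (mulr_ge0 (ltW n0) (ltW t0)).
      rewrite -[X in _ < X]natr1 => h2.
      rewrite [X in _ && X]ler_pdivrMr// [t * _]mulrC h1 andbT.
      rewrite ler_pdivlMr// mulrBl mulVf ?gt_eqF// lerBlDr mulrC.
      exact: ltW.
    + rewrite -[X in _ --> X]subr0; apply: cvgB; first exact: cvg_cst.
      exact: cvg_harmonic.
    + exact: cvg_cst.
  have /continuous_within_itvcyP[cw _] := @cB w.
  have ct : {for t, continuous (fun t : R => B t w)}.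
    by apply: cw; rewrite in_itv/= t0.
  exact: (cvg_comp _ _ st ct).
Qed.

End independent_time.

(** * The mixture kernel *)

Lemma measurable_inv {R : realType} : measurable_fun setT (fun x : R => x^-1).
Proof.
rewrite (_ : (fun x : R => x^-1) =
  (fun x => if 0 <= x then x `^ (-1) else - ((- x) `^ (-1)))).
  apply: measurable_fun_ifT.
  - exact: measurable_fun_ler.
  - exact: measurable_powR.
  - apply: measurable_funN.
    exact: (measurableT_comp (@measurable_powR R (-1)) (@oppr_measurable R setT)).
apply/funext => x; case: ifPn => [x0|]; first by rewrite powR_inv1.
by rewrite -ltNge => x0; rewrite powR_inv1 ?oppr_ge0 ?ltW// invrN opprK.
Qed.

Section mixture_kernel.
Context {R : realType}.
Variables (m sigma S0 tau omega : R).
Hypotheses (hsigma : 0 < sigma) (hS0 : 0 < S0) (htau : 0 < tau) (homega : 0 < omega).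
Implicit Types (x y v t s : R) (n : nat).
Local Notation leb := (@lebesgue_measure R).

(** [kernel_a x] and [kernel_b] are the coefficients of 1 / t and t in the
    exponent; [kernel_scale] collects what does not depend on t. The kernel is
    extended by 0 outside the open quadrant, to be integrated over the plane. *)
Definition kernel_a x := ln (x / S0) ^+ 2 / sigma ^+ 2 + omega.
Definition kernel_b := m ^+ 2 / sigma ^+ 2 + omega / tau ^+ 2.
Definition kernel_scale x :=
  Num.sqrt omega * expR (omega / tau) / (2 * pi * sigma) / x
  * expR (m / sigma ^+ 2 * ln (x / S0)).
Definition mixture_kernel t x := if (0 < t) && (0 < x) then
  kernel_scale x * (t^-1 ^+ 2 * expR (- ((kernel_a x / t + kernel_b * t) / 2))) else 0.

Lemma kernel_a_gt0 x : 0 < kernel_a x.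
Proof. by rewrite /kernel_a ltr_wpDl// divr_ge0 ?sqr_ge0. Qed.

Lemma kernel_b_gt0 : 0 < kernel_b.
Proof. by rewrite /kernel_b ltr_wpDl ?divr_ge0 ?sqr_ge0// divr_gt0 ?exprn_gt0. Qed.

Lemma kernel_scale_ge0 x : 0 <= x -> 0 <= kernel_scale x.
Proof.
move=> x0; apply: mulr_ge0; last exact: expR_ge0.
apply: divr_ge0 => //; apply: divr_ge0; first by rewrite mulr_ge0 ?expR_ge0.
by rewrite mulr_ge0 ?(ltW hsigma)// mulr_ge0 ?pi_ge0.
Qed.

Lemma mixture_kernel_ge0 t x : 0 <= mixture_kernel t x.
Proof.
rewrite /mixture_kernel; case: ifP => // /andP[t0 x0].
by rewrite mulr_ge0 ?kernel_scale_ge0 ?(ltW x0)// mulr_ge0 ?expR_ge0 ?exprn_ge0// invr_ge0 ltW.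
Qed.

Lemma measurable_mixture_kernel :
  measurable_fun setT (fun z : R * R => mixture_kernel z.1 z.2).
Proof.
have mV := @measurable_inv R.
have m1 : measurable_fun setT (fun z : R * R => z.1) by exact: measurable_fst.
have m2 : measurable_fun setT (fun z : R * R => z.2) by exact: measurable_snd.
have m1V : measurable_fun setT (fun z : R * R => z.1^-1) by exact: measurableT_comp mV m1.
have m2V : measurable_fun setT (fun z : R * R => z.2^-1) by exact: measurableT_comp mV m2.
have mL : measurable_fun setT (fun z : R * R => ln (z.2 / S0)).
  apply: (measurableT_comp (@measurable_ln R)).
  by apply: measurable_funM.
apply: measurable_fun_ifT => //.
  by apply: measurable_and; exact: measurable_fun_ltr.
apply: measurable_funM.
  apply: measurable_funM; first by apply: measurable_funM.
  by apply: (measurableT_comp (@measurable_expR R)); apply: measurable_funM.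
apply: measurable_funM; first exact: measurable_funX.
apply: (measurableT_comp (@measurable_expR R)).
apply: measurable_funN; apply: measurable_funM => //.
apply: measurable_funD; last by apply: measurable_funM.
apply: measurable_funM => //; apply: measurable_funD => //.
by apply: measurable_funM => //; exact: measurable_funX.
Qed.

(** The left-hand side is the inverse Gaussian density at [t] times the density
    of [S_t] at [x]. *)
Lemma mixture_kernelE t x : 0 < t -> 0 < x ->
  inverse_gaussian_pdf tau omega t *
    (normal_pdf 0 (Num.sqrt t) ((ln (x / S0) - m * t) / sigma) * (sigma * x)^-1)
  = mixture_kernel t x.
Proof.
move=> t0 x0; rewrite /inverse_gaussian_pdf /mixture_kernel t0 x0/=.
rewrite normal_pdfE ?gt_eqF ?sqrtr_gt0// /normal_peak /normal_fun.
rewrite sqr_sqrtr ?(ltW t0)// subr0.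
have p0 := pi_gt0 R.
have E1 : Num.sqrt (omega / (2 * pi * t ^+ 3)) * (Num.sqrt (t * pi *+ 2))^-1 =
    Num.sqrt omega / (2 * pi) * t^-1 ^+ 2.
  rewrite (sqrtrM _ (ltW homega)) sqrtrV; last by rewrite !mulr_ge0 ?exprn_ge0 ?ltW.
  rewrite -mulrA -invfM -sqrtrM; last by rewrite !mulr_ge0 ?exprn_ge0 ?ltW.
  have -> : 2 * pi * t ^+ 3 * (t * pi *+ 2) = (2 * pi * t ^+ 2) ^+ 2.
    by rewrite -mulr_natr; ring.
  rewrite sqrtr_sqr gtr0_norm; last by rewrite mulr_gt0 ?exprn_gt0// mulr_gt0.
  by rewrite invfM exprVn mulrA.
set e1 := expR _; set e2 := expR _.
transitivity (Num.sqrt (omega / (2 * pi * t ^+ 3)) * (Num.sqrt (t * pi *+ 2))^-1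
  * (e1 * e2) * (sigma * x)^-1); first by ring.
rewrite E1 /kernel_scale -expRD.
set L := ln (x / S0).
have -> : - (omega * (t - tau) ^+ 2 / (2 * tau ^+ 2 * t)) +
    - ((L - m * t) / sigma) ^+ 2 / (t *+ 2) =
  omega / tau + m / sigma ^+ 2 * L + - ((kernel_a x / t + kernel_b * t) / 2).
  rewrite /kernel_a /kernel_b -/L -mulr_natr; field.
  by rewrite !gt_eqF.
rewrite !expRD.
move: (expR (omega / tau)) (expR (m / sigma ^+ 2 * L)) (expR (- _)) => u1 u2 u3.
move: (Num.sqrt omega) => so; move: (@pi R) p0 => p p0.
by field; rewrite !gt_eqF.
Qed.

Lemma integral_mixture_kernel x : (\int[leb]_t (mixture_kernel t x)%:E =
  (if 0 < x then kernel_scale x * (2 * (Num.sqrt kernel_b / Num.sqrt (kernel_a x)) *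
     besselK 1 (Num.sqrt (kernel_a x * kernel_b))) else 0)%:E)%E.
Proof.
have [x0|x0] := ltP 0 x; last first.
  by apply: integral0_eq => t _; rewrite /mixture_kernel (ltNge 0 x) x0 andbF.
have a0 := kernel_a_gt0 x; have b0 := kernel_b_gt0.
transitivity (\int[leb]_(t in `]0%R, +oo[) ((kernel_scale x)%:E *
    (t^-1 ^+ 2 * expR (- ((Num.sqrt (kernel_a x) ^+ 2 / t
      + Num.sqrt kernel_b ^+ 2 * t) / 2)))%:E))%E.
  rewrite [RHS]integral_mkcond; apply: eq_integral => t _.
  rewrite patchE /mixture_kernel x0 andbT; case: ifPn => [t0|t0].
    by rewrite ifT ?inE/= ?in_itv/= ?t0// -EFinM !sqr_sqrtr// ltW.
  by rewrite ifF//; apply/negbTE; rewrite notin_setE/= in_itv/= andbT; exact/negP.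
rewrite ge0_integralZl//; last 3 first.
- apply/measurable_EFinP/measurable_funTS; apply: measurable_funM.
    by apply: measurable_funX; exact: measurable_inv.
  apply: (measurableT_comp (@measurable_expR R)).
  apply: measurable_funN; apply: measurable_funM => //.
  apply: measurable_funD; last by apply: measurable_funM.
  by apply: measurable_funM => //; exact: measurable_inv.
- by move=> t _; rewrite lee_fin mulr_ge0 ?expR_ge0// sqr_ge0.
- by rewrite lee_fin kernel_scale_ge0// ltW.
rewrite integral_inv_sqr_expR ?sqrtr_gt0// -EFinM.
by rewrite besselK1E ?sqrtr_gt0 ?mulr_gt0// sqrtrM ?(ltW a0).
Qed.

End mixture_kernel.

Lemma integral_mixture_kernel_pdf {R : realType} (mu sigma S0 tau omega x : R) :
  0 < sigma -> 0 < S0 -> 0 < tau -> 0 < omega ->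
  (\int[lebesgue_measure]_t
     (mixture_kernel (log_drift mu sigma) sigma S0 tau omega t x)%:E =
    (gbm_ig_pdf mu sigma S0 tau omega x)%:E)%E.
Proof.
move=> s0 S00 t0 o0; rewrite integral_mixture_kernel//; congr EFin.
rewrite /gbm_ig_pdf; case: ifPn => // x0.
set m := log_drift mu sigma.
rewrite -/(kernel_a sigma S0 omega x) -/(kernel_b m sigma tau omega).
have a0 := kernel_a_gt0 sigma S0 o0 x; have b0 := kernel_b_gt0 m sigma t0 o0.
rewrite powRN !div1r !powR12_sqrt ?ltW//.
have xS : 0 < x / S0 by rewrite divr_gt0.
rewrite powRB ?(gt_eqF xS) ?implybT// powRr1 ?(ltW xS)//.
rewrite /powR (gt_eqF xS) /kernel_scale.
have sa : 0 < Num.sqrt (kernel_a sigma S0 omega x) by rewrite sqrtr_gt0.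
move: (besselK 1 _) (expR (omega / tau)) (expR (_ * ln _)) (Num.sqrt omega)
  (Num.sqrt (kernel_b _ _ _ _)) => u1 u2 u3 u4 u5.
move: sa; set u6 := Num.sqrt _ => sa.
have := pi_gt0 R; move: (@pi R) => p p0.
by field; rewrite !gt_eqF.
Qed.

(** * Geometric Brownian motion at an inverse Gaussian time *)

(** As B_0 vanishes almost surely, B_t coincides with its increment over
    [0, t] outside a null set. *)
Lemma brownian_marginal {R : realType} {d : measure_display}
    {Omega : measurableType d} (P : probability Omega R) (B : R -> Omega -> R)
    (t : R) (A : set R) :
  standard_brownian_motion P B -> 0 < t -> measurable A ->
  P (B t @^-1` A) = normal_prob 0 (Num.sqrt t) A.
Proof.
move=> [mB B0 _ BN _] t0 mA.
have := BN 0 t (lexx 0) t0 A mA; rewrite subr0 => <-.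
have mBt : measurable (B t @^-1` A).
  by rewrite -[X in measurable X]setTI; apply: mB => //; exact: ltW.
have mI : measurable (increment B 0 t @^-1` A).
  rewrite -[X in measurable X]setTI; apply: measurable_funB => //.
    by apply: mB; exact: ltW.
  exact: mB.
rewrite -[LHS]mul1e -[RHS]mul1e -(@integral_cst _ _ _ P _ mBt 1).
rewrite -(@integral_cst _ _ _ P _ mI 1).
rewrite integral_mkcond [RHS]integral_mkcond; apply: ae_eq_integral => //.
- by apply/(measurable_restrictT _ mBt).
- by apply/(measurable_restrictT _ mI).
apply: filterS B0 => w Bw0 _; rewrite !patchE; congr (if _ then _ else _).
apply/idP/idP => /set_mem/= h; apply/mem_set => /=;
  by move: h; rewrite /increment Bw0 subr0.
Qed.

(** The law of S_t is the image of a normal law under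
    b |-> S0 exp (m t + sigma b), whose inverse has derivative 1 / (sigma x). *)
Lemma gbm_marginal {R : realType} {d : measure_display}
    {Omega : measurableType d} (P : probability Omega R) (B : R -> Omega -> R)
    (m sigma S0 t : R) (A : set R) :
  standard_brownian_motion P B -> 0 < sigma -> 0 < S0 -> 0 < t -> measurable A ->
  P [set w | A (S0 * expR (m * t + sigma * B t w))] =
  (\int[lebesgue_measure]_(x in `]0%R, +oo[)
     (\1_A x * (normal_pdf 0 (Num.sqrt t) ((ln (x / S0) - m * t) / sigma)
       * (sigma * x)^-1))%:E)%E.
Proof.
move=> hB s0 S00 t0 mA.
pose phi b := S0 * expR (m * t + sigma * b).
pose psi x := (ln (x / S0) - m * t) / sigma.
have mphi : measurable_fun setT phi.
  apply: measurable_funM => //; apply: (measurableT_comp (@measurable_expR R)).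
  by apply: measurable_funD => //; apply: measurable_funM.
have mphiA : measurable (phi @^-1` A) by rewrite -[X in measurable X]setTI; exact: mphi.
rewrite (_ : [set w | _] = B t @^-1` (phi @^-1` A)); last by [].
rewrite brownian_marginal// /normal_prob.
transitivity (\int[lebesgue_measure]_b
    (\1_(phi @^-1` A) b * normal_pdf 0 (Num.sqrt t) b)%:E)%E.
  rewrite integral_mkcond; apply: eq_integral => b _.
  by rewrite patchE indicE; case: ifP => _; rewrite ?mul1r ?mul0r.
transitivity (\int[lebesgue_measure]_(x in `]0%R, +oo[)
    ((\1_(phi @^-1` A) (psi x) * normal_pdf 0 (Num.sqrt t) (psi x))%:E
      * ((sigma * x)^-1)%:E))%E.
  apply: (@ge0_integral_substitution_pos _ psi phi (fun x => (sigma * x)^-1)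
    (fun b => (\1_(phi @^-1` A) b * normal_pdf 0 (Num.sqrt t) b)%:E)).
  - by move=> b; rewrite mulr_gt0 ?expR_gt0.
  - move=> b; rewrite /psi /phi [S0 * _]mulrC mulfK ?gt_eqF// expRK.
    by rewrite addrC addKr mulrC mulKf ?gt_eqF.
  - move=> x y x0 xy; rewrite /psi ltr_pM2r ?invr_gt0// ltrD2r ltr_ln ?posrE ?divr_gt0//.
      by rewrite ltr_pM2r ?invr_gt0.
    exact: lt_trans xy.
  - move=> x x0; have ? : 0 < x / S0 by rewrite divr_gt0.
    have dl := @is_derive1_ln R (x / S0) (divr_gt0 x0 S00).
    have ? : is_derive x 1 (@ln R \o (fun x : R => x / S0)) x^-1.
      apply: is_derive_eq; rewrite /GRing.scale/= ?mulr1 ?scaler0 ?addr0.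
      by field; rewrite !gt_eqF.
    rewrite /psi; apply: is_derive_eq.
    by rewrite /GRing.scale/=; field; rewrite !gt_eqF.
  - move=> x x0; apply: cvgV; first by rewrite gt_eqF// mulr_gt0.
    by apply: cvgMl_tmp; exact: cvg_id.
  - by move=> x x0; rewrite invr_ge0 mulr_ge0// ltW.
  - apply/measurable_EFinP; apply: measurable_funM; last exact: measurable_normal_pdf.
    exact: measurable_indic.
  - by move=> b; rewrite lee_fin mulr_ge0 ?normal_pdf_ge0.
apply: eq_integral => x; rewrite inE/= in_itv/= andbT => x0.
rewrite -EFinM -mulrA; congr (_ * _)%:E.
rewrite !indicE; congr (nat_of_bool _)%:R.
have xE : phi (psi x) = x.
  rewrite /phi /psi [sigma * _]mulrC divfK ?gt_eqF// addrC subrK lnK ?posrE ?divr_gt0//.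
  by rewrite mulrC divfK ?gt_eqF.
by apply/idP/idP => /set_mem h; apply/mem_set; move: h; rewrite /= xE.
Qed.

Theorem mainTheorem5 (R : realType) (d : measure_display)
    (Omega : measurableType d) (P : probability Omega R)
    (B : R -> Omega -> R) (T : Omega -> R) (mu sigma S0 tau omega : R)
    (hB : standard_brownian_motion P B)
    (hsigma : 0 < sigma) (hS0 : 0 < S0) (htau : 0 < tau) (homega : 0 < omega)
    (hT0 : forall w : Omega, 0 <= T w)
    (hT : has_pdf P T (inverse_gaussian_pdf tau omega))
    (hTB : independent_of_process P T B) :
  has_pdf P (fun w => gbm mu sigma S0 B (T w) w)
    (gbm_ig_pdf mu sigma S0 tau omega).
Proof.
pose m := log_drift mu sigma.
have [mB _ cB _ _] := hB; have [mT mf f0 _] := hT.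
pose X (z : R * g_sigma_algebraType (process_cylinders B)) : R :=
  S0 * expR (m * z.1 + sigma * B (Num.max z.1 0) z.2).
have mX : measurable_fun setT X.
  have mBt := measurable_continuous_process cB.
  apply: measurable_funM => //; apply: (measurableT_comp (@measurable_expR R)).
  by apply: measurable_funD; apply: measurable_funM.
have XE w : gbm mu sigma S0 B (T w) w = X (T w, w).
  by rewrite /X /= (max_idPl (hT0 w)).
pose k t x := mixture_kernel m sigma S0 tau omega t x.
have k0 t x : 0 <= k t x by exact: mixture_kernel_ge0.
have mk : measurable_fun setT
    (fun z : measurableTypeR R * measurableTypeR R => (k z.1 z.2)%:E).
  by apply/measurable_EFinP; exact: measurable_mixture_kernel.
have kE x :=
  @integral_mixture_kernel_pdf R mu sigma S0 tau omega x hsigma hS0 htau homega.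
(* as an integral of the jointly measurable kernel, the density is measurable *)
have mpdf : measurable_fun setT (gbm_ig_pdf mu sigma S0 tau omega).
  apply/measurable_EFinP.
  have := measurable_fun_fubini_tonelli_G (m1 := @lebesgue_measure R) _ mk
    (fun z => k0 z.1 z.2 : (0 <= (k z.1 z.2)%:E)%E).
  by apply: eq_measurable_fun => x _; rewrite /fubini_G /= kE.
have pdf0 x : 0 <= gbm_ig_pdf mu sigma S0 tau omega x.
  by rewrite -lee_fin -kE; apply: integral_ge0 => t _; rewrite lee_fin.
split => //.
  rewrite (_ : (fun w => _) = (fun w => X (T w, w))); last exact/funext.
  exact: measurable_at_random_time.
move=> A mA.
rewrite (_ : _ @^-1` A = [set w | A (X (T w, w))]); last first.
  by apply/seteqP; split => w /=; rewrite XE.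
rewrite (probability_at_random_time mT mB hTB hT mX mA).
have mA' : measurable_fun setT (\1_A : R -> R) by exact: measurable_indic.
pose h (t x : R) : R := \1_A x * k t x.
transitivity (\int[lebesgue_measure]_t \int[lebesgue_measure]_x (h t x)%:E)%E.
  apply: eq_integral => t _; have [t0|t0] := ltP 0 t; last first.
    rewrite /inverse_gaussian_pdf (ltNge 0 t) t0 mule0; apply/esym/integral0_eq => x _.
    by rewrite /h /k /mixture_kernel (ltNge 0 t) t0 mulr0.
  have mg : measurable_fun setT (fun x : R => (\1_A x * (normal_pdf 0 (Num.sqrt t)
      ((ln (x / S0) - m * t) / sigma) * (sigma * x)^-1))).
    apply: measurable_funM => //; apply: measurable_funM.
      apply: (measurableT_comp (@measurable_normal_pdf R 0 (Num.sqrt t))).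
      apply: measurable_funM => //; apply: measurable_funB => //.
      by apply: (measurableT_comp (@measurable_ln R)); apply: measurable_funM.
    by apply: (measurableT_comp (@measurable_inv R)); apply: measurable_funM.
  rewrite /X /= (max_idPl (ltW t0)) (gbm_marginal _ hB)// muleC -ge0_integralZl//.
  - rewrite integral_mkcond; apply: eq_integral => x _; rewrite patchE.
    case: ifPn => [|x0]; last first.
      rewrite /h /k /mixture_kernel (_ : (0 < x) = false) ?andbF ?mulr0//.
      by apply/negbTE; move: x0; rewrite notin_setE/= in_itv/= andbT => /negP.
    rewrite inE/= in_itv/= andbT => x0.
    by rewrite -EFinM mulrCA /h mixture_kernelE.
  - by apply/measurable_EFinP/measurable_funTS.
  - move=> x; rewrite /= in_itv/= andbT => x0.
    by rewrite lee_fin !mulr_ge0 ?normal_pdf_ge0// invr_ge0 mulr_ge0// ltW.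
  - by rewrite lee_fin f0.
have mAk : measurable_fun setT
    (fun z : measurableTypeR R * measurableTypeR R => (h z.1 z.2)%:E).
  apply/measurable_EFinP; apply: measurable_funM; last exact/measurable_EFinP.
  by apply: (measurableT_comp mA'); exact: measurable_snd.
transitivity (\int[lebesgue_measure]_x \int[lebesgue_measure]_t (h t x)%:E)%E.
  apply: (fubini_tonelli (m1 := @lebesgue_measure R) (m2 := @lebesgue_measure R)
    _ mAk) => z.
  by rewrite lee_fin mulr_ge0.
rewrite [RHS]integral_mkcond; apply: eq_integral => x _.
rewrite patchE /h indicE; case: ifP => _.
  by rewrite -kE; apply: eq_integral => t _; rewrite mul1r.
by apply: integral0_eq => t _; rewrite mul0r.
Qed.
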